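(* There are infinitely many positive integers $k$ such that $k^2+1$ is square-free. Moreover, for all sufficiently large such $k$, the field $K_k=\mathbb{Q}\big(\sqrt{k^2+1+\sqrt{k^2+1}}\big)$ satisfies \[ 4^{-2/3}\, D_{K_k}^{1/6} \le M(\mathcal{O}_{K_k}) \le 60\, D_{K_k}^{1/6}. \]
   Context: For a nonconstant polynomial $f(x)=c\prod_{i=1}^d (x-\alpha_i)\in\mathbb{C}[x]$, the Mahler measure is $M(f)=|c|\prod_{|\alpha_i|\ge 1}|\alpha_i|$. For an algebraic number $\alpha$, $M(\alpha)$ is the Mahler measure of its minimal polynomial over $\mathbb{Z}$ (with content $1$). For a number field $K$ with ring of integers $\mathcal{O}_K$ and absolute discriminant $D_K$, $M(\mathcal{O}_K)=\min\{M(\alpha):\alpha\in\mathcal{O}_K,\ \mathbb{Q}(\alpha)=K\}$. *)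

(* Defs.v *)
(* number fields realized as subfields Q(theta) of algC. *)
From mathcomp Require Import all_boot all_order all_algebra all_field.
From mathcomp Require Import algC algnum.
Set Implicit Arguments. Unset Strict Implicit. Unset Printing Implicit Defensive.
Import Order.TTheory GRing.Theory Num.Theory.
Local Open Scope ring_scope.

Definition squarefree (n : nat) : Prop :=
  forall p : nat, prime p -> ~~ (p * p %| n)%N.

Definition ratp (p : {poly rat}) : {poly algC} := map_poly ratr p.
Definition intp (p : {poly int}) : {poly algC} := map_poly intr p.

Definition inQgen (theta x : algC) : Prop :=
  exists q : {poly rat}, x = (ratp q).[theta].

Definition generates (theta beta : algC) : Prop :=
  (forall x, inQgen theta x <-> inQgen beta x).

Definition inOK (theta x : algC) : Prop := inQgen theta x /\ x \in Aint.

Definition is_minpolyQ (theta : algC) (p : {poly rat}) : Prop :=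
  p \is monic /\ root (ratp p) theta /\
  forall q : {poly rat}, q != 0 -> root (ratp q) theta -> (size p <= size q)%N.

(* p is the minimal polynomial of beta over Z with content 1
   (normalized with positive leading coefficient) *)
Definition is_minpolyZ (beta : algC) (p : {poly int}) : Prop :=
  p != 0 /\ root (intp p) beta /\ zcontents p = 1 /\
  forall q : {poly int}, q != 0 -> root (intp q) beta -> (size p <= size q)%N.

Definition mahler_poly (f : {poly algC}) (m : algC) : Prop :=
  exists rs : seq algC,
    f = lead_coef f *: \prod_(r <- rs) ('X - r%:P) /\
    m = `|lead_coef f| * \prod_(r <- rs | 1 <= `|r|) `|r|.

Definition mahler_alg (beta m : algC) : Prop :=
  exists p : {poly int}, is_minpolyZ beta p /\ mahler_poly (intp p) m.

Definition is_mahler_OK (theta m : algC) : Prop :=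
  (exists beta, inOK theta beta /\ generates theta beta /\ mahler_alg beta m) /\
  forall beta m', inOK theta beta -> generates theta beta -> mahler_alg beta m' ->
    m <= m'.

(* D = |disc(O_K)| for K = Q(theta): c enumerates the conjugates of theta
   (giving the embeddings q(theta) |-> q(c i)), w is a Z-basis of O_K, and
   D = |det (sigma_i(w_j))|^2. *)
Definition is_abs_disc (theta D : algC) : Prop :=
  exists (p : {poly rat}) (n : nat) (c : 'I_n -> algC) (w : 'I_n -> {poly rat}),
    is_minpolyQ theta p /\
        ratp p = \prod_(i < n) ('X - (c i)%:P) /\
        (forall j, inOK theta (ratp (w j)).[theta]) /\
        (forall x, inOK theta x ->
           exists a : 'I_n -> int, x = \sum_(j < n) (a j)%:~R * (ratp (w j)).[theta]) /\
        (forall a : 'I_n -> int,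
           \sum_(j < n) (a j)%:~R * (ratp (w j)).[theta] = 0 -> forall j, a j = 0) /\
        D = `|\det (\matrix_(i < n, j < n) (ratp (w j)).[c i])| ^+ 2.

Definition theta_k (k : nat) : algC :=
  sqrtC ((k ^ 2 + 1)%N%:R + sqrtC (k ^ 2 + 1)%N%:R).

(* Main.v *)
(** Put [d = k^2 + 1], [s = sqrt d], [t = sqrt (d + s)] and [u = sqrt (d - s) = t (s - 1) / k], so
    that [K_k = Q(t)] is a totally real cyclic quartic field whose Galois group is generated by
    [(s, t, u) |-> (- s, u, - t)].  For square-free [d] its integers have the basis [1, w, t, u] with
    [w = s] ([k] odd) or [w = (1 + s) / 2] ([k] even), hence [D = 256 d^3] or [D = 64 d^3]; this is
    a 2-adic analysis of the traces and norms to [Q(s)].  An integer [x = a + b w + c t + e u]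
    generates the field iff [(c, e) <> 0], and its conjugates then satisfy
    [(x_1 - x_2) (x_3 - x_4) = 4 s (k (c^2 - e^2) - 2 c e)], which gives [M(x) >= s].  The unit
    [k - s + t - u] has two bounded conjugates, one of size about [4 s] and one of size at most [1].
    The minimum exists because [M(x)] bounds all four coordinates.

    For square-free values of [k^2 + 1], only the squares of primes [p = 4 j + 1] can divide
    [k^2 + 1], each for at most [2 (N / p^2 + 1)] of the [k < N]; summing over [4 j + 1 < N] discards
    at most [N / 2 + N / 6] of them. *)

Require Import Defs.
From mathcomp Require Import all_boot all_order all_algebra all_field.
From mathcomp Require Import algC algnum.
From mathcomp Require Import zify ring lra.
Set Implicit Arguments. Unset Strict Implicit. Unset Printing Implicit Defensive.
Import Order.TTheory GRing.Theory Num.Theory.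
Local Open Scope ring_scope.

(** * Square-free values of [k ^ 2 + 1] *)

(** If [p] is 3 modulo 4, then (p - 1) / 2 is odd, so a square root [x] of -1 in ['F_p] satisfies
    [x ^+ p = - x], whereas Frobenius gives [x ^+ p = x]. *)
Lemma prime_dvdn_sqrS (p k : nat) :
  prime p -> (p %| k ^ 2 + 1)%N -> (p == 2)%N || (p %% 4 == 1)%N.
Proof.
move=> pr_p dvd_p; have p_gt1 := prime_gt1 pr_p.
case: (eqVneq p 2%N) => //= p_neq2.
have odd_p : odd p by case: (even_prime pr_p) p_neq2 => [->|].
suff : (p %% 4 != 3)%N by lia.
apply/negP => p_mod4.
pose x : 'F_p := k%:R.
have x2 : x ^+ 2 = -1.
  move: dvd_p; rewrite (dvdn_pcharf (pchar_Fp pr_p)) natrD natrX addr_eq0.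
  exact: eqP.
have xp := expf_card x; rewrite card_Fp // in xp.
have : x ^+ p = - x.
  transitivity (x ^+ (2 * (p %/ 4).*2.+1).+1); first by congr (x ^+ _); lia.
  by rewrite exprS exprM x2 -signr_odd /= odd_double /= expr1 mulrN1.
rewrite xp => /eqP; rewrite -addr_eq0 -mulr2n -mulr_natl mulf_eq0.
case/orP => [|/eqP x0].
  rewrite -(dvdn_pcharf (pchar_Fp pr_p)) => /(dvdn_leq (ltn0Sn _)).
  by move: p_gt1 p_neq2; lia.
by move: x2; rewrite x0 expr0n /= => /eqP; rewrite eq_sym oppr_eq0 oner_eq0.
Qed.

(** [p ^ 2] divides [(r - t) (r + t)], and [p] cannot divide both factors: it would divide [2 r],
    hence [r], hence 1. So [p ^ 2] divides one factor, and the size of [r] and [t] does the rest. *)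
Lemma sqrS_roots_mod_sqr (p r t : nat) :
  prime p -> odd p -> (r < p ^ 2)%N -> (t < p ^ 2)%N ->
  (p ^ 2 %| r ^ 2 + 1)%N -> (p ^ 2 %| t ^ 2 + 1)%N ->
  (r == t) || (r == p ^ 2 - t)%N.
Proof.
move=> pr_p odd_p; have p_gt1 := prime_gt1 pr_p.
wlog le_tr : r t / (t <= r)%N => [hw lr lt dr dt|lr lt dr dt].
  case: (leqP t r) => [/hw|/ltnW /hw /(_ lt lr dt dr)]; first exact.
  by lia.
have dvd_prod : (p ^ 2 %| (r - t) * (r + t))%N.
  have -> : ((r - t) * (r + t) = (r ^ 2 + 1) - (t ^ 2 + 1))%N.
    by rewrite subnDr subn_sqr.
  by rewrite dvdn_sub.
have npr : ~~ (p %| r)%N.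
  apply/negP => p_r; have : (p %| r ^ 2 + 1)%N.
    by apply: dvdn_trans dr; rewrite dvdn_exp.
  rewrite dvdn_addr ?dvdn_exp2r //; last by rewrite dvdn_exp.
  by rewrite dvdn1; case: (p) p_gt1 => [|[]].
case: (boolP (p %| r + t)%N) => p_rt.
  have np : ~~ (p %| r - t)%N.
    apply/negP => p_r_t; move: npr; apply/negP/negPn.
    have : (p %| 2 * r)%N.
      have -> : (2 * r = (r - t) + (r + t))%N by lia.
      by rewrite dvdn_add.
    by rewrite Euclid_dvdM // (dvdn_prime2 pr_p) // => /orP [/eqP p2|//]; move: odd_p; rewrite p2.
  move: dvd_prod; rewrite Gauss_dvdr; last by rewrite coprime_pexpl // prime_coprime.
  move=> /dvdnP [q eq_q].
  case: (posnP t) => [t0|t_gt0].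
    by move: dt; rewrite t0 dvdn1; case: (p) p_gt1 => [|[]].
  by case: q eq_q => [|[|q]]; lia.
move: dvd_prod; rewrite Gauss_dvdl; last by rewrite coprime_pexpl // prime_coprime.
move=> /dvdnP [q eq_q].
by case: q eq_q => [|q]; lia.
Qed.

Lemma count_sqrS_period (p : nat) : prime p -> odd p ->
  (\sum_(0 <= r < p ^ 2) (p ^ 2 %| r ^ 2 + 1) <= 2)%N.
Proof.
move=> pr_p odd_p.
rewrite -big_mkcond /= sum1_count -size_filter.
set s := filter _ _.
have s_uniq : uniq s by rewrite filter_uniq // iota_uniq.
case Ds: s => [//|t s']; rewrite -Ds.
have t_in : t \in s by rewrite Ds inE eqxx.
apply: (@uniq_leq_size _ s [:: t; p ^ 2 - t]%N) => // r.
move: t_in; rewrite /s !mem_filter !mem_index_iota /= !inE => /andP [dt lt] /andP [dr lr].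
exact: (@sqrS_roots_mod_sqr p).
Qed.

(** Divisibility by [p ^ 2] depends on [k] modulo [p ^ 2] only, so [N] is rounded up to a whole
    number of periods with at most two hits each. *)
Lemma count_sqrS_le (p N : nat) : prime p -> odd p ->
  (\sum_(0 <= k < N) (p ^ 2 %| k ^ 2 + 1) <= 2 * (N %/ p ^ 2).+1)%N.
Proof.
move=> pr_p odd_p; have p_gt0 := prime_gt0 pr_p.
set Q := (p ^ 2)%N.
have Q_gt0 : (0 < Q)%N by rewrite expn_gt0 p_gt0.
have per n : (\sum_(0 <= k < n * Q) (Q %| k ^ 2 + 1) <= 2 * n)%N.
  elim: n => [|n IHn]; first by rewrite mul0n big_geq.
  rewrite (@big_cat_nat _ _ _ (n * Q)%N) //=; last by rewrite leq_mul2r leqnSn orbT.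
  rewrite mulnS addnC leq_add // mulSn.
  rewrite -{1}[(n * Q)%N]add0n big_addn addnK.
  apply: leq_trans (count_sqrS_period pr_p odd_p).
  rewrite leq_eqVlt; apply/orP; left; apply/eqP; apply: eq_bigr => i _.
  have -> : ((i + n * Q) ^ 2 + 1 = (i ^ 2 + 1) + Q * (n * (n * Q) + 2 * i * n))%N.
    by ring.
  by rewrite dvdn_addl // dvdn_mulr.
apply: leq_trans (per (N %/ Q).+1).
have le_N : (N <= (N %/ Q).+1 * Q)%N by apply: ltnW; rewrite -ltn_divLR.
by rewrite [X in (_ <= X)%N](@big_cat_nat _ _ _ N) //= leq_addr.
Qed.

(** Telescoping: 1 / (4j+1)^2 is at most 1 / ((4j-1)(4j+3)), a quarter of 1 / (4j-1) - 1 / (4j+3).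
    The sum starts at 1/3, whence the bound [N / 12]. *)
Lemma sum_divn_sqr (N M : nat) : (0 < M)%N ->
  (12 * \sum_(1 <= j < M) N %/ (4 * j + 1) ^ 2 <= N)%N.
Proof.
have tele n : (\sum_(1 <= j < n.+1) N %/ (4 * j + 1) ^ 2)%N%:R
   <= N%:R / 4 * (1 / 3 - 1 / (4 * n%:R + 3)) :> rat.
  elim: n => [|n IHn]; first by rewrite big_geq // (_ : 4 * 0%:R + 3 = 3 :> rat) ?subrr ?mulr0.
  rewrite big_nat_recr //= natrD.
  have le_div : (N %/ (4 * n.+1 + 1) ^ 2)%:R <= N%:R / (4 * n.+1%:R + 1) ^+ 2 :> rat.
    rewrite ler_pdivlMr; last by rewrite exprn_gt0 // ltr_wpDl // mulr_ge0.
    rewrite -[X in (_ + X) ^+ _]/(1%:R) -natrM -natrD -natrX -natrM ler_nat.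
    exact: leq_divM.
  apply: le_trans (lerD IHn le_div) _.
  rewrite -(natr1 n); set x : rat := n%:R.
  have x_ge0 : 0 <= x by apply: ler0n.
  have step : 1 / (4 * (x + 1) + 1) ^+ 2 <= 1 / 4 * (1 / (4 * x + 3) - 1 / (4 * (x + 1) + 3)) :> rat.
    have -> : 1 / 4 * (1 / (4 * x + 3) - 1 / (4 * (x + 1) + 3))
           = 1 / ((4 * x + 3) * (4 * (x + 1) + 3)) :> rat.
      by field; rewrite !lt0r_neq0 //; lra.
    rewrite !div1r lef_pV2 ?posrE; first by nra.
      by apply: exprn_gt0; lra.
    by apply: mulr_gt0; lra.
  have N_ge0 : 0 <= N%:R :> rat by apply: ler0n.
  have := ler_wpM2l N_ge0 step; rewrite !div1r.
  move: ((4 * (x + 1) + 1) ^+ 2)^-1 (4 * x + 3)^-1 (4 * (x + 1) + 3)^-1 => i1 i2 i3.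
  by rewrite !mulrBr; lra.
case: M => // n _; have := tele n.
set S := (\sum_(1 <= j < n.+1) _)%N => le_S.
rewrite -(@ler_nat rat) natrM.
have N_ge0 : 0 <= N%:R :> rat by apply: ler0n.
have n_ge0 : 0 <= 1 / (4 * n%:R + 3) :> rat.
  by apply: divr_ge0 => //; apply: addr_ge0 => //; apply: mulr_ge0.
by have := mulr_ge0 N_ge0 n_ge0; move: (1 / (_ + 3)) le_S => i; rewrite !mulrBr; lra.
Qed.

(** If each of the [3 M] integers [k] in [M, 4M) had a bad [j], double counting the pairs [(k, j)]
    would contradict the two preceding bounds. *)
Lemma infinite_squarefree_sqrS (N0 : nat) :
  exists k : nat, (N0 < k)%N /\ squarefree (k ^ 2 + 1).
Proof.
pose M := N0.+1; pose N := (4 * M)%N.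
pose bad k j := prime (4 * j + 1) && ((4 * j + 1) ^ 2 %| k ^ 2 + 1)%N.
case: (boolP (has (fun k => ~~ has (bad k) (index_iota 1 M)) (index_iota M N))).
  case/hasP => k; rewrite mem_index_iota => /andP [lt_k lt_kN] /hasPn good.
  exists k; split => // p pr_p; apply/negP => dvd_p.
  have p_gt1 := prime_gt1 pr_p.
  have dp : (p %| k ^ 2 + 1)%N by apply: dvdn_trans dvd_p; rewrite dvdn_mulr.
  (* Otherwise [k + 1 <= N <= p], but [(k + 1) ^ 2] exceeds [k ^ 2 + 1]. *)
  have lt_p : (p < N)%N.
    have : (p * p <= k ^ 2 + 1)%N by apply: dvdn_leq dvd_p; rewrite addn1.
    rewrite -mulnn => le_p; rewrite ltnNge; apply/negP => le_Np.
    have : (k.+1 * k.+1 <= p * p)%N by apply: leq_mul; apply: leq_trans le_Np.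
    by lia.
  case/orP: (prime_dvdn_sqrS pr_p dp) => [/eqP p2|/eqP p_mod4].
    (* [k ^ 2 + 1] is 1 or 2 modulo 4. *)
    move: dvd_p; rewrite p2 => /dvdnP [q]; move: (odd_double_half k) => <-.
    by case: (odd k); rewrite -mul2n -mulnn; lia.
  have Dp : (4 * (p %/ 4) + 1)%N = p by rewrite [in RHS](divn_eq p 4) p_mod4 mulnC.
  have := good (p %/ 4)%N; rewrite mem_index_iota /bad Dp pr_p -mulnn dvd_p /=.
  suff -> : (1 <= p %/ 4 < M)%N by move/(_ isT).
  apply/andP; split; last by rewrite /N in lt_p; lia.
  by case: (p %/ 4)%N Dp => [|//]; move=> Dp; move: p_gt1; rewrite -Dp.
move/hasPn => all_bad; exfalso.
have lower : (N - M <= \sum_(0 <= k < N) \sum_(1 <= j < M) bad k j)%N.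
  rewrite (@big_cat_nat _ _ _ M) //=; last by rewrite /N leq_pmull.
  apply: leq_trans (leq_addl _ _).
  rewrite -[X in (X <= _)%N]muln1 -sum_nat_const_nat.
  rewrite big_seq [X in (_ <= X)%N]big_seq; apply: leq_sum => k /all_bad /negPn.
  by rewrite -big_mkcond /= sum1_count -has_count.
have upper : (\sum_(0 <= k < N) \sum_(1 <= j < M) bad k j
     <= \sum_(1 <= j < M) 2 * (N %/ (4 * j + 1) ^ 2).+1)%N.
  rewrite exchange_big /=; apply: leq_sum => j _; rewrite /bad.
  case: (boolP (prime _)) => [pr_q|_] /=; last by rewrite big1.
  by apply: count_sqrS_le => //; rewrite addn1 /= oddM.
have := leq_trans lower upper.
rewrite -big_distrr /=.
have -> : (\sum_(1 <= j < M) (N %/ (4 * j + 1) ^ 2).+1 =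
   (M - 1) + \sum_(1 <= j < M) (N %/ (4 * j + 1) ^ 2))%N.
  rewrite -[(M - 1)%N]muln1 -sum_nat_const_nat -big_split /=.
  by apply: eq_bigr.
(* With [S] the sum of quotients, [3 M <= 2 (M - 1) + 2 S] is incompatible with [12 S <= 4 M]. *)
have := @sum_divn_sqr N M isT.
by rewrite /N /M; lia.
Qed.

(** * Field operations in Q(x) *)

Section Qgen.
Variable x : algC.

Lemma inQgen_ratr (r : rat) : inQgen x (ratr r).
Proof. by exists r%:P; rewrite /ratp map_polyC hornerC. Qed.

Lemma inQgen_Crat (r : algC) : r \in Crat -> inQgen x r.
Proof. by case/CratP => q ->; apply: inQgen_ratr. Qed.

Lemma inQgen_id : inQgen x x.
Proof. by exists 'X; rewrite /ratp map_polyX hornerX. Qed.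

Lemma inQgenD (y z : algC) : inQgen x y -> inQgen x z -> inQgen x (y + z).
Proof. by case=> p -> [q ->]; exists (p + q); rewrite /ratp rmorphD hornerD. Qed.

Lemma inQgenM (y z : algC) : inQgen x y -> inQgen x z -> inQgen x (y * z).
Proof. by case=> p -> [q ->]; exists (p * q); rewrite /ratp rmorphM hornerM. Qed.

Lemma inQgenN (y : algC) : inQgen x y -> inQgen x (- y).
Proof. by case=> p ->; exists (- p); rewrite /ratp rmorphN hornerN. Qed.

Lemma inQgenB (y z : algC) : inQgen x y -> inQgen x z -> inQgen x (y - z).
Proof. by move=> hy hz; apply: inQgenD => //; apply: inQgenN. Qed.

(* Bezout with the minimal polynomial of [x]: a factor of it not vanishing at [x] is constant. *)
Lemma inQgenV (y : algC) : inQgen x y -> inQgen x y^-1.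
Proof.
case: (eqVneq y 0) => [-> _|y_neq0 [q Dy]].
  by rewrite invr0; apply: inQgen_Crat; apply: rpred0.
have [p [Dp p_monic] p_min] := minCpolyP x.
have px0 : (ratp p).[x] = 0.
  by apply/eqP; rewrite -[_ == 0]/(root _ _) p_min dvdpp.
have [[v1 v2] /= Dg] := Bezoutp q p.
set g := gcdp q p in Dg.
have g_root : ~~ root (ratp g) x.
  apply/negP; rewrite p_min => p_g.
  have : root (ratp q) x by rewrite p_min (dvdp_trans p_g) // dvdp_gcdl.
  by rewrite /root -Dy (negPf y_neq0).
have [h Dh] : exists h, p = h * g by apply/dvdpP; rewrite dvdp_gcdr.
have p_h : p %| h.
  rewrite -p_min /root; move: px0; rewrite Dh /ratp rmorphM hornerM => /eqP.
  by rewrite mulf_eq0 => /orP [//|gx0]; case/negP: g_root.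
have g_const : size g = 1%N.
  have p_neq0 := monic_neq0 p_monic.
  have h_neq0 : h != 0 by apply: contraNneq p_neq0 => h0; rewrite Dh h0 mul0r.
  have g_neq0 : g != 0 by apply: contraNneq p_neq0 => g0; rewrite Dh g0 mulr0.
  have := dvdp_leq h_neq0 p_h; rewrite Dh size_mul //.
  have := size_poly_gt0 g; rewrite g_neq0; lia.
have /eqpP [[c1 c2] /= /andP [c1_neq0 c2_neq0] Dc] := Dg.
have [c c_neq0 Dgc] : exists2 c, c != 0 & g = c%:P.
  by apply/size_poly1P; rewrite g_const.
exists ((c1 / (c2 * c)) *: v1).
have c2c_neq0 : c2 * c != 0 by rewrite mulf_neq0.
apply: (mulIf y_neq0); rewrite mulVf // Dy /ratp linearZ /= hornerZ -mulrA -hornerM -rmorphM.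
have : (ratp (c1 *: (v1 * q + v2 * p))).[x] = ratr (c2 * c).
  by rewrite Dc Dgc -mul_polyC -polyCM /ratp map_polyC hornerC.
rewrite /ratp linearZ /= hornerZ rmorphD /= hornerD [map_poly _ (v2 * p)]rmorphM.
rewrite hornerM -/(ratp p) px0 mulr0 addr0 => E.
by rewrite fmorph_div mulrAC E divff // fmorph_eq0.
Qed.

End Qgen.

Lemma inQgen_trans (x y z : algC) : inQgen x y -> inQgen y z -> inQgen x z.
Proof.
case=> p Dy [q ->]; exists (q \Po p).
by rewrite /ratp map_comp_poly horner_comp -[map_poly ratr p]/(ratp p) -Dy.
Qed.

(** * Minima over integer quadruples *)

(** The order on [algC] is partial; the values are taken real so that any two of them compare. *)
Lemma seq_argmin (T : eqType) (F : T -> algC) (l : seq T) (x0 : T) :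
  (forall x, x \in l -> F x \is Num.real) -> x0 \in l ->
  exists2 x, x \in l & forall y, y \in l -> F x <= F y.
Proof.
elim: l x0 => [//|a l IHl] x0 F_real _.
case: l IHl F_real => [|b l] IHl F_real.
  by exists a; rewrite ?mem_head // => y; rewrite inE => /eqP ->.
have [||x x_l x_min] := IHl b; [|exact: mem_head|].
  by move=> y y_l; apply: F_real; rewrite inE y_l orbT.
have [|lt_xa|le_ax] := real_leP (F_real a (mem_head _ _)) (F_real x _).
- by rewrite inE x_l orbT.
- exists a; rewrite ?mem_head // => y; rewrite inE => /orP [/eqP -> //|/x_min].
  exact: le_trans.
exists x; first by rewrite inE x_l orbT.
move=> y; rewrite inE => /orP [/eqP ->|/x_min //]; exact: ltW.
Qed.

Lemma mem_pairs (T : eqType) (l : seq T) (x y : T) :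
  x \in l -> y \in l -> (x, y) \in [seq (x, y) | x <- l, y <- l].
Proof. by move=> hx hy; apply: (allpairs_f (fun x y => (x, y))). Qed.

(** Since [F] bounds every coordinate, the quadruples with value at most the initial one lie in a
    finite box; a minimum over the box is global, as any other quadruple has a value above the
    initial one. *)
Lemma int4_argmin (F : int -> int -> int -> int -> algC)
    (P : int -> int -> int -> int -> bool) (a0 b0 c0 e0 : int) :
  (forall a b c e, P a b c e -> [/\ `|a%:~R| <= F a b c e, `|b%:~R| <= F a b c e,
     `|c%:~R| <= F a b c e & `|e%:~R| <= F a b c e]) ->
  P a0 b0 c0 e0 ->
  exists a b c e, P a b c e /\
    forall a' b' c' e', P a' b' c' e' -> F a b c e <= F a' b' c' e'.
Proof.
move=> F_bound P0.
have F_ge0 a b c e : P a b c e -> 0 <= F a b c e.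
  by case/F_bound => ha *; apply: le_trans ha.
pose N := Num.bound (F a0 b0 c0 e0).
have ltN : F a0 b0 c0 e0 < N%:R by apply: archi_boundP; apply: F_ge0.
pose r : seq int := [seq i%:Z - N%:Z | i <- iota 0 (2 * N + 1)].
have rP (i : int) : `|i%:~R| <= F a0 b0 c0 e0 -> i \in r.
  move=> /le_lt_trans /(_ ltN); rewrite -intr_norm -[N%:R]/(N%:Z%:~R) ltr_int => lt_iN.
  apply/mapP; exists (absz (i + N%:Z)%R); last by lia.
  by rewrite mem_iota; lia.
pose F' (x : (int * int) * (int * int)) := F x.1.1 x.1.2 x.2.1 x.2.2.
pose P' (x : (int * int) * (int * int)) := P x.1.1 x.1.2 x.2.1 x.2.2.
pose r2 := [seq (x, y) | x <- r, y <- r].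
pose box := [seq x <- [seq (x, y) | x <- r2, y <- r2] | P' x].
have boxP a b c e : P a b c e -> F a b c e <= F a0 b0 c0 e0 ->
    ((a, b), (c, e)) \in box.
  move=> Pa le_F; have [ha hb hc he] := F_bound _ _ _ _ Pa.
  rewrite mem_filter; apply/andP; split=> //.
  by apply: mem_pairs; apply: mem_pairs; apply: rP; apply: le_trans le_F.
have [||[[a b] [c e]] in_box min_box] := @seq_argmin _ F' box ((a0, b0), (c0, e0)).
- by move=> x; rewrite mem_filter => /andP [/F_ge0 /ger0_real].
- by apply: boxP.
move: in_box; rewrite mem_filter /P' /= => /andP [Pa _].
exists a, b, c, e; split=> // a' b' c' e' Pa'.
have le0 : F a b c e <= F a0 b0 c0 e0 by apply: (min_box ((a0, b0), (c0, e0))); apply: boxP.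
have [le_F'|lt_F'] := real_leP (ger0_real (F_ge0 _ _ _ _ Pa')) (ger0_real (F_ge0 _ _ _ _ P0)).
  exact: (min_box ((a', b'), (c', e')) (boxP _ _ _ _ Pa' le_F')).
exact: le_trans le0 (ltW lt_F').
Qed.

(** * Parity analysis of integral coordinates *)

(** A certificate scheme: the multiplier [u] shows that [n] times the goal follows from [a = b],
    which leaves a polynomial identity to check. *)
Lemma lincomb1 (R : idomainType) (n u a b x y : R) :
  n != 0 -> a = b -> n * (x - y) = u * (a - b) -> x = y.
Proof.
move=> n_neq0 ->; rewrite subrr mulr0 => /eqP.
by rewrite mulf_eq0 (negPf n_neq0) subr_eq0 => /eqP.
Qed.

Lemma lincomb2 (R : idomainType) (n u a b v c d x y : R) :
  n != 0 -> a = b -> c = d -> n * (x - y) = u * (a - b) + v * (c - d) -> x = y.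
Proof.
by move=> n_neq0 -> ->; rewrite !subrr !mulr0 addr0 -[0](mulr0 n) => /(mulfI n_neq0) /subr0_eq.
Qed.

Lemma int_parity (n : int) : (exists m, n = 2 * m) \/ (exists m, n = 2 * m + 1).
Proof.
have := divz_eq n 2; have : 0 <= (n %% 2)%Z < 2 by rewrite modz_ge0 // ltz_pmod.
move=> bound Dn; have [m0|m1] : (n %% 2)%Z = 0 \/ (n %% 2)%Z = 1 by lia.
  by left; exists (n %/ 2)%Z; lia.
by right; exists (n %/ 2)%Z; lia.
Qed.

(** For opposite parities the second left side is odd; for two odd numbers the first is 2 modulo
    4. *)
Lemma even_coords_of_trace (k C E y z : int) :
  k * (C ^+ 2 - E ^+ 2) - 2 * C * E = 4 * y ->
  C ^+ 2 - E ^+ 2 + 2 * C * E * k = 2 * z ->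
  (exists C', C = 2 * C') /\ (exists E', E = 2 * E').
Proof.
case: (int_parity C) => [[c ->]|[c ->]]; case: (int_parity E) => [[e ->]|[e ->]];
  by move=> h1 h2; split; first [by eexists | exfalso; lia].
Qed.

(** For an integer with coordinates [A/4, B/4, C/2, E/2] on [1, s, t, u], [n1] is the norm from Q(s)
    of its relative trace, [(U + V s) / 2] its relative norm and [n2] its absolute norm. Here [d] is
    1 modulo 4. *)
Lemma integral_coords_even (k A B C E n1 n2 U V : int) :
  let d := (2 * k) ^+ 2 + 1 in
  A ^+ 2 - d * B ^+ 2 = 4 * n1 ->
  A ^+ 2 + d * B ^+ 2 - 4 * d * (C ^+ 2 + E ^+ 2) = 8 * U ->
  A * B - 2 * (C ^+ 2 - E ^+ 2 + 2 * C * E * (2 * k)) = 4 * V ->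
  U ^+ 2 - d * V ^+ 2 = 4 * n2 ->
  exists a b c e, [/\ A = 4 * a + 2 * b, B = 2 * b, C = 2 * c & E = 2 * e].
Proof.
move=> d; rewrite {}/d => hN hU hV hUV.
have [w DU] : exists w, U = V + 2 * w.
  have {}hUV : U ^+ 2 - V ^+ 2 = 4 * (n2 + k ^+ 2 * V ^+ 2) by rewrite mulrDr -hUV; ring.
  move: (n2 + _) hUV => q {hN hU hV}.
  case: (int_parity U) => [[u ->]|[u ->]]; case: (int_parity V) => [[v ->]|[v ->]] hUV;
    first [by exists (u - v); ring | exfalso; lia].
have [[A1 DA] [B1 DB]] : (exists A1, A = 2 * A1) /\ (exists B1, B = 2 * B1).
  have {}hN : A ^+ 2 - B ^+ 2 = 4 * (n1 + k ^+ 2 * B ^+ 2) by rewrite mulrDr -hN; ring.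
  have {}hV : A * B = 2 * (2 * V + (C ^+ 2 - E ^+ 2 + 2 * C * E * (2 * k))).
    by rewrite mulrDr mulrA -hV; ring.
  move: (n1 + _) (2 * V + _) hN hV => q1 q2 {hU hUV}.
  case: (int_parity A) => [[a ->]|[a ->]]; case: (int_parity B) => [[b ->]|[b ->]] hN hV;
    first [by split; eexists | exfalso; lia].
subst A B U; clear hN hUV.
(* Subtracting twice [hV] from [hU] cancels the terms in [C ^+ 2] modulo 16 and completes the square
   in [A1 - B1]. *)
have hE : (A1 - B1) ^+ 2 - 2 * E ^+ 2 =
    4 * (w - k ^+ 2 * B1 ^+ 2 + k ^+ 2 * (C ^+ 2 + E ^+ 2) - C * E * k).
  by apply: (@lincomb2 _ 4 1 _ _ (- 2) _ _ _ _ _ hU hV) => //; ring.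
have [[a Da] [e De]] : (exists a, A1 - B1 = 2 * a) /\ (exists e, E = 2 * e).
  move: (A1 - B1) (w - _ + _ - _) hE => m q {hU hV}.
  case: (int_parity m) => [[a ->]|[a ->]]; case: (int_parity E) => [[e ->]|[e ->]] hE;
    first [by split; eexists | exfalso; lia].
have {}hV : C ^+ 2 = 2 * (A1 * B1 - 2 * C * E * k - V + 2 * e ^+ 2).
  by apply: (@lincomb1 _ 2 (- 1) _ _ _ _ _ hV) => //; rewrite De; ring.
have [c Dc] : exists c, C = 2 * c.
  move: (_ - _ + _) hV => q {hE hU}.
  by case: (int_parity C) => [[c ->]|[c ->]] hC; first [by eexists | exfalso; lia].
by exists a, B1, c, e; split=> //; rewrite -[A1](subrK B1) Da; ring.
Qed.

(** Same setting, now with [d] equal to 2 modulo 4: a norm form [x ^+ 2 - d * y ^+ 2] divisible by 4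
    forces [x], then [y], to be even, which applies to [(A, B)] and to [(U, V)]. *)
Lemma integral_coords_odd (k A B C E n1 n2 U V : int) :
  let d := (2 * k + 1) ^+ 2 + 1 in
  A ^+ 2 - d * B ^+ 2 = 4 * n1 ->
  A ^+ 2 + d * B ^+ 2 - 4 * d * (C ^+ 2 + E ^+ 2) = 8 * U ->
  A * B - 2 * (C ^+ 2 - E ^+ 2 + 2 * C * E * (2 * k + 1)) = 4 * V ->
  U ^+ 2 - d * V ^+ 2 = 4 * n2 ->
  exists a b c e, [/\ A = 4 * a, B = 4 * b, C = 2 * c & E = 2 * e].
Proof.
move=> d; rewrite {}/d => hN hU hV hUV.
have even2 (x y n : int) : x ^+ 2 - ((2 * k + 1) ^+ 2 + 1) * y ^+ 2 = 4 * n ->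
    (exists x', x = 2 * x') /\ (exists y', y = 2 * y').
  move=> h; have {}h : x ^+ 2 - 2 * y ^+ 2 = 4 * (n + (k ^+ 2 + k) * y ^+ 2).
    by rewrite mulrDr -h; ring.
  move: (n + _) h => q {hN hU hV hUV}.
  case: (int_parity x) => [[u ->]|[u ->]]; case: (int_parity y) => [[v ->]|[v ->]] h;
    first [by split; eexists | exfalso; lia].
have [[A1 DA] [B1 DB]] := even2 _ _ _ hN.
have [[U1 DU] [V1 DV]] := even2 _ _ _ hUV.
subst A B U V; clear even2 hUV hN.
have hA : A1 ^+ 2 = 2 * (2 * U1 + (2 * (k ^+ 2 + k) + 1) * (C ^+ 2 + E ^+ 2 - B1 ^+ 2)).
  by apply: (@lincomb1 _ 4 1 _ _ _ _ _ hU) => //; ring.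
have [A2 DA] : exists A2, A1 = 2 * A2.
  move: (2 * U1 + _) hA => q {hU hV}.
  by case: (int_parity A1) => [[a ->]|[a ->]] hA; first [by eexists | exfalso; lia].
subst A1.
have {}hV : C ^+ 2 - E ^+ 2 + 2 * C * E = 4 * (A2 * B1 - V1 - C * E * k).
  by apply: (@lincomb1 _ 2 (- 1) _ _ _ _ _ hV) => //; ring.
have [[c Dc] [e De]] : (exists c, C = 2 * c) /\ (exists e, E = 2 * e).
  move: (_ - _ - _) hV => q {hU hA}.
  case: (int_parity C) => [[c ->]|[c ->]]; case: (int_parity E) => [[e ->]|[e ->]] hE;
    first [by split; eexists | exfalso; lia].
subst C E.
(* Once [C] and [E] are known to be even, [hA] yields a further factor 2 and hence the parity of
   [B1]. *)
have {}hA : B1 ^+ 2 = 2 * (U1 - A2 ^+ 2 + (k ^+ 2 + k) * (4 * c ^+ 2 + 4 * e ^+ 2 - B1 ^+ 2)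
    + 2 * c ^+ 2 + 2 * e ^+ 2).
  by apply: (@lincomb1 _ 2 1 _ _ _ _ _ hA) => //; ring.
have [B2 DB] : exists B2, B1 = 2 * B2.
  move: (_ + _ + _) hA => q {hU hV}.
  by case: (int_parity B1) => [[b ->]|[b ->]] hB; first [by eexists | exfalso; lia].
by exists A2, B2, c, e; split=> //; rewrite ?DB; ring.
Qed.

(** The square of the reduced denominator of [r] divides [n], so the denominator has no prime
    factor. *)
Lemma squarefree_sqr_int (n : nat) (r : algC) : squarefree n ->
  r \in Crat -> r ^+ 2 * n%:R \in Num.int -> r \in Num.int.
Proof.
move=> sqf_n /CratP [x ->] /intrP [z Dz].
suff : denq x = 1 by move=> den1; rewrite -[x]divq_num_den den1 divr1 ratr_int intr_int.
have {}Dz : x ^+ 2 * n%:R = z%:~R.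
  by apply: (fmorph_inj (@ratr algC)); rewrite rmorphM rmorphXn /= ratr_nat ratr_int.
have Dx : (numq x) ^+ 2 * n%:Z = z * denq x ^+ 2.
  apply/eqP; rewrite -(eqr_int rat) intrM [X in _ == X]intrM !rmorphXn /= -Dz numqE -[n%:~R]/(n%:R).
  by rewrite exprMn mulrAC.
have Dn : (`|numq x| ^ 2 * n = `|z| * `|denq x| ^ 2)%N.
  by have := congr1 absz Dx; rewrite !abszM !mulnn.
have : (`|denq x| ^ 2 %| n)%N.
  have cop : coprime (`|denq x| ^ 2) (`|numq x| ^ 2).
    by apply/coprimeXl/coprimeXr; rewrite coprime_sym; apply: coprime_num_den.
  by rewrite -(Gauss_dvdr n cop) Dn dvdn_mull.
have den_gt0 := denq_gt0 x.
case: (leqP `|denq x| 1) => [|gt1]; first by lia.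
have := sqf_n _ (pdiv_prime gt1); rewrite mulnn => /negP H dvd_n; case: H.
by apply: dvdn_trans dvd_n; rewrite dvdn_exp2r // pdiv_dvd.
Qed.

(** * Conjugate triples and rational coordinates *)

(* Satisfied by [s = sqrt (K^2 + 1)], [t = sqrt (s^2 + s)], [u = sqrt (s^2 - s)]
   and stable under [(s, t, u) |-> (- s, u, - t)], a generator of the Galois group. *)
Definition quartic_rel (K s t u : algC) : Prop :=
  [/\ s * s = K ^+ 2 + 1, s * t = K * u + t, s * u = K * t - u
    & [/\ t * t = s * s + s, t * u = K * s & u * u = s * s - s]].

Lemma quartic_rel_rot (K s t u : algC) : quartic_rel K s t u -> quartic_rel K (- s) u (- t).
Proof.
case=> ss st su [tt tu uu]; split; rewrite ?mulrNN ?mulrN ?mulNr //.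
- by rewrite su opprB addrC.
- by rewrite st opprK.
by split; rewrite ?mulrNN ?uu ?tt ?mulrN ?[u * t]mulrC ?tu ?opprK.
Qed.

Lemma quartic_rel_neg (K s t u : algC) : quartic_rel K s t u -> quartic_rel K s (- t) (- u).
Proof. by move=> /quartic_rel_rot /quartic_rel_rot; rewrite opprK. Qed.

Lemma quartic_rel_rot3 (K s t u : algC) : quartic_rel K s t u -> quartic_rel K (- s) (- u) t.
Proof. by move=> /quartic_rel_rot /quartic_rel_neg; rewrite opprK. Qed.

(** The triple stays an argument, so that conjugation is the substitution of another triple
    satisfying [quartic_rel]. *)
Definition elt (a b c e s t u : algC) : algC := a + b * s + c * t + e * u.

Lemma ratpD (p q : {poly rat}) : ratp (p + q) = ratp p + ratp q.
Proof. exact: rmorphD. Qed.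

Lemma ratpN (p : {poly rat}) : ratp (- p) = - ratp p.
Proof. exact: rmorphN. Qed.

Lemma ratpM (p q : {poly rat}) : ratp (p * q) = ratp p * ratp q.
Proof. exact: rmorphM. Qed.

Lemma ratpXn (p : {poly rat}) (n : nat) : ratp (p ^+ n) = ratp p ^+ n.
Proof. exact: rmorphXn. Qed.

Lemma ratpC (a : rat) : ratp a%:P = (ratr a)%:P.
Proof. exact: map_polyC. Qed.

Lemma ratpX : ratp 'X = 'X.
Proof. exact: map_polyX. Qed.

Definition ratpE := (ratpD, ratpN, ratpXn, ratpM, ratpC, ratpX).

(** The coordinates depend on [q] alone and serve all triples at once; this uniformity replaces
    field automorphisms. *)
Lemma horner_elt (k : nat) (q : {poly rat}) : exists a b c e : rat,
  forall s t u, quartic_rel k%:R s t u ->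
    (ratp q).[t] = elt (ratr a) (ratr b) (ratr c) (ratr e) s t u.
Proof.
elim/poly_ind: q => [|q r [a [b [c [e IHq]]]]].
  by exists 0, 0, 0, 0 => s t u _; rewrite /elt /ratp rmorph0 horner0 rmorph0; ring.
exists (c * (k%:R ^+ 2 + 1) + r), (c + e * k%:R), (a + b), (b * k%:R) => s t u rel.
rewrite !ratpE !hornerE (IHq _ _ _ rel) /elt.
rewrite !rmorphD !rmorphM /= rmorphD /= rmorph1 rmorphXn /= ratr_nat.
case: rel => ss st su [tt tu uu].
by rewrite !mulrDl -!mulrA st tt [u * t]mulrC tu ss; ring.
Qed.

Lemma elt_horner (k : nat) (a b c e : rat) : (0 < k)%N -> exists q : {poly rat},
  forall s t u, quartic_rel k%:R s t u ->
    (ratp q).[t] = elt (ratr a) (ratr b) (ratr c) (ratr e) s t u.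
Proof.
move=> k_gt0; pose K : rat := k%:R.
have K_neq0 : k%:R != 0 :> algC by rewrite pnatr_eq0 -lt0n.
(* From the relations, [s = t^2 - (K^2 + 1)] and [K u = t^3 - (K^2 + 2) t]. *)
exists (a%:P + b%:P * ('X ^+ 2 - (K ^+ 2 + 1)%:P) + c%:P * 'X
   + (e / K)%:P * ('X ^+ 3 - (K ^+ 2 + 2)%:P * 'X)) => s t u [ss st su [tt tu uu]].
rewrite !ratpE !(hornerE, hornerXn, horner_exp).
rewrite fmorph_div !(rmorphD _ (K ^+ 2)) rmorphXn /= rmorph1 !ratr_nat /elt.
have -> : t ^+ 2 = k%:R ^+ 2 + 1 + s by rewrite expr2 tt ss.
have -> : t ^+ 3 = (k%:R ^+ 2 + 1) * t + k%:R * u + t.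
  by rewrite exprS expr2 tt ss mulrC mulrDl st; ring.
by field.
Qed.

Ltac crat := repeat first
  [ assumption | exact: rpred_nat | exact: rpred1 | exact: rpred0 | apply: rpredD
  | rewrite rpredN | apply: rpredX | rewrite rpredV | apply: rpredM ].

(** * Minimal polynomials and Mahler measures of algebraic integers *)

Lemma intp_inj : injective intp.
Proof. exact: (map_inj_poly (@intr_inj algC)). Qed.

Lemma size_intp (p : {poly int}) : size (intp p) = size p.
Proof. exact: (size_map_inj_poly (@intr_inj algC)). Qed.

Lemma lead_coef_intp (p : {poly int}) : lead_coef (intp p) = (lead_coef p)%:~R.
Proof. exact: (lead_coef_map_inj (@intr_inj algC)). Qed.

Lemma ratp_intr (p : {poly int}) : ratp (map_poly intr p) = intp p.
Proof.
by rewrite /ratp -map_poly_comp; apply: eq_map_poly => i /=; rewrite ratr_int.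
Qed.

Lemma minCpoly_dvd_intp (x : algC) (p : {poly int}) :
  root (intp p) x -> minCpoly x %| intp p.
Proof.
have [q [-> _] q_min] := minCpolyP x.
by rewrite -ratp_intr q_min -[map_poly ratr q]/(ratp q) dvdp_map.
Qed.

(** A minimal polynomial over Z is [lead_coef p] times the monic integral one; [zcontents] is
    signed, so content 1 makes this factor 1. Two root lists of one polynomial are permutations of
    each other. *)
Lemma mahler_alg_Aint (x m : algC) (rs : seq algC) :
  x \in Aint -> minCpoly x = \prod_(r <- rs) ('X - r%:P) ->
  mahler_alg x m <-> m = \prod_(r <- rs | 1 <= `|r|) `|r|.
Proof.
move=> /floorpP [p0 Dp0] Drs; rewrite -/(intp p0) in Dp0.
have p0_monic : p0 \is monic.
  by have := minCpoly_monic x; rewrite Dp0 !monicE lead_coef_intp -[1]/(1%:~R) eqr_int.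
have p0_root : root (intp p0) x by rewrite -Dp0 root_minCpoly.
split=> [[p [[p_neq0 [p_root [p_cont p_min]]] [rs' [Dp ->]]]]|->].
  have size_p : size (minCpoly x) == size (intp p).
    rewrite eqn_leq dvdp_leq ?minCpoly_dvd_intp //=; last first.
      by rewrite -size_poly_eq0 size_intp size_poly_eq0.
    by rewrite Dp0 !size_intp p_min // monic_neq0.
  have /eqpf_eq [c c_neq0 Dc] : intp p %= minCpoly x.
    by rewrite eqp_sym -dvdp_size_eqp // minCpoly_dvd_intp.
  have lead_c : c = (lead_coef p)%:~R.
    by rewrite -lead_coef_intp Dc lead_coefZ (monicP (minCpoly_monic x)) mulr1.
  have Dp' : p = lead_coef p *: p0.
    by apply: intp_inj; rewrite Dc lead_c Dp0 /intp linearZ.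
  have lead1 : lead_coef p = 1.
    by move: p_cont; rewrite Dp' zcontentsZ zcontents_monic // mulr1 -Dp'.
  have Dp1 : intp p = minCpoly x by rewrite Dc lead_c lead1 scale1r.
  rewrite lead_coef_intp lead1 normr1 mul1r.
  apply: perm_big; apply: prod_XsubC_eq; rewrite -Drs -Dp1 Dp lead_coef_intp lead1.
  by rewrite scale1r.
exists p0; split.
  split; first exact: monic_neq0.
  split=> //; split; first exact: zcontents_monic.
  move=> q q_neq0 q_root; rewrite -!size_intp -Dp0.
  apply: dvdp_leq; last exact: minCpoly_dvd_intp.
  by rewrite -size_poly_eq0 size_intp size_poly_eq0.
exists rs; rewrite lead_coef_intp (monicP p0_monic) normr1 mul1r scale1r; split=> //.
by rewrite -Dp0.
Qed.

(** The right side is the norm from Q(s) of the relative quadratic polynomial. It shows that the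
    product of the four conjugate factors has rational coefficients. *)
Lemma quartic_prod (R : comNzRingType) (X K a b c e s t u : R) :
  s * s = K ^+ 2 + 1 -> t * t = s * s + s -> t * u = K * s -> u * u = s * s - s ->
  (X - (a + b * s + c * t + e * u)) * (X - (a + b * s - c * t - e * u)) *
  ((X - (a - b * s + c * u - e * t)) * (X - (a - b * s - c * u + e * t))) =
  ((X - a) ^+ 2 + (b ^+ 2 - c ^+ 2 - e ^+ 2) * (K ^+ 2 + 1)) ^+ 2
  - (K ^+ 2 + 1) * (2 * b * (X - a) + c ^+ 2 - e ^+ 2 + 2 * c * e * K) ^+ 2.
Proof.
move=> ss tt tu uu.
transitivity (((X - a - b * s) ^+ 2 - (c ^+ 2 * (t * t) + e ^+ 2 * (u * u) + 2 * c * e * (t * u)))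
  * ((X - a + b * s) ^+ 2 - (c ^+ 2 * (u * u) + e ^+ 2 * (t * t) - 2 * c * e * (t * u)))).
  by ring.
by rewrite tt uu tu -ss; ring.
Qed.

Lemma uniq4 (T : eqType) (x y z w : T) : uniq [:: x; y; z; w] =
  [&& x != y, x != z, x != w, y != z, y != w & z != w].
Proof. by rewrite /= !inE !negb_or andbT -!andbA. Qed.

Lemma polyC_elt (a b c e s t u : algC) :
  (elt a b c e s t u)%:P = a%:P + b%:P * s%:P + c%:P * t%:P + e%:P * u%:P.
Proof. by rewrite /elt !(polyCD, polyCM). Qed.

Lemma Aint_sqr (x : algC) : x ^+ 2 \in Aint -> x \in Aint.
Proof.
move=> xx_int; apply: (@root_monic_Aint (minCpoly (x ^+ 2) \Po 'X^2)).
- by rewrite /root horner_comp hornerXn; apply: root_minCpoly.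
- rewrite monicE lead_coef_comp ?size_polyXn // lead_coefXn expr1n mulr1.
  by rewrite -monicE minCpoly_monic.
by apply: polyOver_comp => //; rewrite rpredX // polyOverX.
Qed.

Lemma half_int (n : nat) : n%:Z = 2 * n./2%:Z + (odd n)%:Z.
Proof. by lia. Qed.

(** * The function max(1, |x|) and a determinant formula *)

(** The form a factor of the filtered product in the Mahler measure takes when its condition is
    moved inside. *)
Definition max1 (x : algC) : algC := if 1 <= `|x| then `|x| else 1.

Lemma max1_ge1 (x : algC) : 1 <= max1 x.
Proof. by rewrite /max1; case: ifP. Qed.

Lemma max1_ge_norm (x : algC) : `|x| <= max1 x.
Proof.
rewrite /max1; case: ifP => // /negbT.
by rewrite -real_ltNge ?real1 ?normr_real // => /ltW.
Qed.

Lemma max1_le (x y : algC) : 1 <= y -> `|x| <= y -> max1 x <= y.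
Proof. by rewrite /max1; case: ifP. Qed.

Lemma max1_ge0 (x : algC) : 0 <= max1 x.
Proof. exact: le_trans ler01 (max1_ge1 x). Qed.

Lemma norm_sub_max1 (x y : algC) : `|x - y| <= 2 * (max1 x * max1 y).
Proof.
rewrite (le_trans (ler_normB _ _)) // mulr_natl mulr2n lerD //.
  by apply: le_trans (max1_ge_norm x) _; rewrite ler_peMr ?max1_ge0 ?max1_ge1.
by apply: le_trans (max1_ge_norm y) _; rewrite ler_peMl ?max1_ge0 ?max1_ge1.
Qed.

(** Expansion along the first row; [bump j] lists the three columns other than [j], so [g], [h] and
    [l] are the columns of the minor. *)
Lemma det4 (R : comNzRingType) (f : nat -> nat -> R) :
  \det (\matrix_(i < 4, j < 4) f i j) =
  \sum_(j < 4) f 0%N j * (-1) ^+ j *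
    (let g i := f i (bump j 0) in let h i := f i (bump j 1) in let l i := f i (bump j 2) in
     g 1%N * (h 2%N * l 3%N - h 3%N * l 2%N) - h 1%N * (g 2%N * l 3%N - g 3%N * l 2%N)
     + l 1%N * (g 2%N * h 3%N - g 3%N * h 2%N)).
Proof.
have det2 (M : 'M[R]_2) : \det M = M ord0 ord0 * M ord_max ord_max - M ord0 ord_max * M ord_max ord0.
  rewrite (expand_det_row _ ord0) !big_ord_recl big_ord0 /cofactor !det_mx11 !mxE /= addr0.
  rewrite addn0 expr0 expr1 mul1r mulN1r mulrN.
  by congr (_ * M _ _ - M _ _ * M _ _); apply: val_inj.
rewrite (expand_det_row _ ord0); apply: eq_bigr => j _.
rewrite mxE -mulrA; congr (_ * _); rewrite /cofactor add0n; congr (_ * _).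
rewrite (expand_det_row _ ord0) !big_ord_recl big_ord0 /cofactor !det2 !mxE /=.
rewrite /bump /= !addn0 ?add0n ?addn1 expr0 expr1 sqrrN expr1n; ring.
Qed.

(** * Linear independence of 1, s, t, u *)

Section Field.

Variable k : nat.
Hypotheses (k_gt0 : (0 < k)%N) (sqf_k : squarefree (k ^ 2 + 1)).

Let K : algC := k%:R.
Let s : algC := sqrtC (k ^ 2 + 1)%N%:R.
Let t : algC := theta_k k.
Let u : algC := t * (s - 1) / K.

Let K_neq0 : K != 0. Proof. by rewrite pnatr_eq0 -lt0n. Qed.

Let K_rat : K \in Crat. Proof. exact: rpred_nat. Qed.

Lemma natr_sqrS : (k ^ 2 + 1)%N%:R = K ^+ 2 + 1.
Proof. by rewrite natrD natrX. Qed.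

Lemma s_gt0 : 0 < s.
Proof. by rewrite /s sqrtC_gt0 ltr0n addn1. Qed.

Lemma s_sqr : s * s = K ^+ 2 + 1.
Proof. by rewrite -expr2 /s sqrtCK natr_sqrS. Qed.

Lemma t_sqr : t * t = s * s + s.
Proof. by rewrite -expr2 /t /theta_k sqrtCK -/s s_sqr -natr_sqrS. Qed.

Lemma theta_rel : quartic_rel K s t u.
Proof.
have ss := s_sqr; have tt := t_sqr.
have Ku : K * u = t * (s - 1) by rewrite /u mulrC divfK.
have su : s * u = K * t - u.
  apply: (@lincomb2 _ K s _ _ t _ _ _ _ K_neq0 Ku ss).
  rewrite -[u in LHS](mulfK K_neq0) [u * K]mulrC Ku; field => //.
have tu : t * u = K * s.
  apply: (mulfI K_neq0); rewrite mulrCA Ku mulrA tt.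
  by apply: (@lincomb1 _ 1 s _ _ _ _ (oner_neq0 _) ss); ring.
have uu : u * u = s * s - s.
  apply: (mulfI K_neq0); rewrite mulrA Ku mulrAC tu.
  by ring.
by split=> //; rewrite Ku; ring.
Qed.

(** Such an [r] would be an integer, while [k ^ 2 + 1] lies strictly between the squares of [k] and
    [k + 1]. *)
Lemma sqrt_irrational (r : algC) : r \in Crat -> r ^+ 2 != K ^+ 2 + 1.
Proof.
move=> r_rat; apply/eqP => Dr.
have /intrP [n Dn] : r \in Num.int.
  apply: (@squarefree_sqr_int 1) => //.
    by move=> p /prime_gt1; rewrite dvdn1; case: p => [|[]].
  by rewrite mulr1 Dr rpredD ?rpredX ?rpred_nat ?rpred1.
have : n ^+ 2 = k%:Z ^+ 2 + 1.
  by apply/eqP; rewrite -(eqr_int algC) rmorphD !rmorphXn /= -Dn Dr.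
rewrite -real_normK ?num_real //; move: `|n| (normr_ge0 n) => m m_ge0.
have [le_mk|lt_km] : m <= k%:Z \/ k%:Z + 1 <= m by lia.
  by have := ler_pM m_ge0 m_ge0 le_mk le_mk; rewrite -!expr2; lia.
have k1_ge0 : 0 <= k%:Z + 1 by lia.
by have := ler_pM k1_ge0 k1_ge0 lt_km lt_km; rewrite -!expr2; lia.
Qed.

Lemma quadratic_indep (a b : algC) : a \in Crat -> b \in Crat ->
  a + b * s = 0 -> a = 0 /\ b = 0.
Proof.
move=> a_rat b_rat ab0; case: (eqVneq b 0) => [b0|b_neq0].
  by move: ab0; rewrite b0 mul0r addr0.
have /negP[] := @sqrt_irrational (- a / b) ltac:(crat).
rewrite -s_sqr expr2; suff -> : - a / b = s by [].
by apply: (mulIf b_neq0); rewrite divfK // -[RHS](addKr a) mulrC ab0 addr0.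
Qed.

(** With [d = K^2 + 1], squaring [t = a + b s] gives [a^2 + b^2 d = d] and [2 a b = 1], so
    [(a^2 - b^2 d)^2 = d^2 - d = K^2 d] and [d] would be a rational square. *)
Lemma theta_notin_quadratic (a b : algC) : a \in Crat -> b \in Crat -> t != a + b * s.
Proof.
move=> a_rat b_rat; apply/eqP => Dt.
have tt := t_sqr; rewrite Dt in tt.
have [] := @quadratic_indep (a ^+ 2 + b ^+ 2 * (K ^+ 2 + 1) - (K ^+ 2 + 1)) (2 * a * b - 1).
- by crat.
- by crat.
- by rewrite -s_sqr; apply: (@lincomb1 _ 1 1 _ _ _ _ (oner_neq0 _) tt); ring.
move=> /subr0_eq e1 /subr0_eq e2.
have /negP[] := @sqrt_irrational ((a ^+ 2 - b ^+ 2 * (K ^+ 2 + 1)) / K) ltac:(crat).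
rewrite expr_div_n; apply/eqP.
apply: (mulIf (expf_neq0 2 K_neq0)); rewrite divfK ?expf_neq0 //.
have -> : (a ^+ 2 - b ^+ 2 * (K ^+ 2 + 1)) ^+ 2 =
   (a ^+ 2 + b ^+ 2 * (K ^+ 2 + 1)) ^+ 2 - (2 * a * b) ^+ 2 * (K ^+ 2 + 1) by ring.
by rewrite e1 e2; ring.
Qed.

(** Since [K u = t (s - 1)], the element is [a + b s + t w] with [w = (c - f) + f s]. If the norm
    [N] of [w] is nonzero, solving for [t] would put it in Q(s). *)
Lemma elt_indep (a b c e : algC) :
  a \in Crat -> b \in Crat -> c \in Crat -> e \in Crat ->
  elt a b c e s t u = 0 -> [/\ a = 0, b = 0, c = 0 & e = 0].
Proof.
move=> a_rat b_rat c_rat e_rat.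
pose f := e / K; have f_rat : f \in Crat by crat.
have De : e = f * K by rewrite divfK.
have -> : elt a b c e s t u = a + b * s + t * ((c - f) + f * s).
  by rewrite /elt De -mulrA [K * u]mulrC divfK //; ring.
pose N := (c - f) ^+ 2 - f ^+ 2 * (K ^+ 2 + 1).
have N_rat : N \in Crat by crat.
have DN : ((c - f) + f * s) * ((c - f) - f * s) = N by rewrite /N -s_sqr; ring.
case: (eqVneq N 0) => [N0|N_neq0].
  have [cf f0] : c - f = 0 /\ f = 0.
    move/eqP: DN; rewrite N0 mulf_eq0 => /orP [/eqP|/eqP h].
      by apply: quadratic_indep; crat.
    have [] := @quadratic_indep (c - f) (- f); [by crat | by crat | by rewrite mulNr |].
    by move=> -> /eqP; rewrite oppr_eq0 => /eqP.
  have c0 : c = 0 by rewrite -(subrK f c) cf f0 addr0.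
  have e0 : e = 0 by rewrite De f0 mul0r.
  rewrite cf f0 mul0r addr0 mulr0 addr0 => E.
  by have [-> ->] := quadratic_indep a_rat b_rat E; rewrite c0 e0.
move=> E; exfalso.
have /eqP[] := @theta_notin_quadratic
   (- (a * (c - f) - b * f * (K ^+ 2 + 1)) / N) (- (b * (c - f) - a * f) / N)
   ltac:(crat) ltac:(crat).
apply: (@lincomb1 _ N (c - f - f * s) _ _ _ _ N_neq0 E).
rewrite mulrBr; set p := - (a * _ - _); set q := - (b * _ - _).
have -> : N * (p / N + q / N * s) = p + q * s by field.
by rewrite -DN /p /q -s_sqr; ring.
Qed.

Lemma inQgen_eltP (x : algC) : inQgen t x <->
  exists a b c e, [/\ a \in Crat, b \in Crat, c \in Crat & e \in Crat]
    /\ x = elt a b c e s t u.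
Proof.
split=> [[q ->]|[a [b [c [e [[/CratP [a' ->] /CratP [b' ->] /CratP [c' ->] /CratP [e' ->]] ->]]]]]].
  have [a [b [c [e Dq]]]] := horner_elt k q.
  exists (ratr a), (ratr b), (ratr c), (ratr e); split; first by split; apply: Crat_rat.
  exact: (Dq _ _ _ theta_rel).
have [q Dq] := elt_horner a' b' c' e' k_gt0.
by exists q; rewrite (Dq _ _ _ theta_rel).
Qed.

(** * Conjugates and minimal polynomials *)

(** Writing the element as [q(t)], the coordinates of [p(q(t))] vanish by independence, and the same
    coordinates give the value at any other triple. *)
Lemma conj_root (p : {poly rat}) (a b c e s' t' u' : algC) :
  a \in Crat -> b \in Crat -> c \in Crat -> e \in Crat -> quartic_rel K s' t' u' ->
  root (ratp p) (elt a b c e s t u) -> root (ratp p) (elt a b c e s' t' u').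
Proof.
move=> /CratP [a' ->] /CratP [b' ->] /CratP [c' ->] /CratP [e' ->] rel'.
have [q Dq] := elt_horner a' b' c' e' k_gt0.
rewrite -(Dq _ _ _ theta_rel) -(Dq _ _ _ rel') /root -!horner_comp -[(ratp p \Po ratp q)]map_comp_poly.
have [a1 [b1 [c1 [e1 Dpq]]]] := horner_elt k (p \Po q).
rewrite -[map_poly _ _]/(ratp (p \Po q)) (Dpq _ _ _ theta_rel) (Dpq _ _ _ rel') => /eqP.
by case/elt_indep; rewrite ?Crat_rat // => -> -> -> ->; rewrite /elt !mul0r !addr0.
Qed.

Lemma conj_Aint (a b c e s' t' u' : algC) :
  a \in Crat -> b \in Crat -> c \in Crat -> e \in Crat -> quartic_rel K s' t' u' ->
  elt a b c e s t u \in Aint -> elt a b c e s' t' u' \in Aint.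
Proof.
move=> a_rat b_rat c_rat e_rat rel' x_int.
have [p [Dp p_monic] _] := minCpolyP (elt a b c e s t u).
apply: (@root_monic_Aint (minCpoly (elt a b c e s t u))) => //.
- by rewrite Dp; apply: conj_root => //; rewrite /ratp -Dp root_minCpoly.
- exact: minCpoly_monic.
Qed.

(** The first two and the last two are the pairs conjugate over Q(s). *)
Definition conjs (a b c e : algC) : seq algC :=
  [:: elt a b c e s t u; elt a b c e s (- t) (- u);
      elt a b c e (- s) u (- t); elt a b c e (- s) (- u) t].

Lemma conjs_rel (P : algC -> Prop) (a b c e : algC) :
  (forall s' t' u', quartic_rel K s' t' u' -> P (elt a b c e s' t' u')) ->
  {in conjs a b c e, forall x, P x}.
Proof.
move=> hP x; rewrite !inE.
have r1 := theta_rel; have r2 := quartic_rel_neg r1.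
have r3 := quartic_rel_rot r1; have r4 := quartic_rel_rot3 r1.
by case/or4P => /eqP ->; apply: hP.
Qed.

(** Each difference is again of the form [elt], and its last two coordinates vanish only when [c]
    and [e] do. *)
Lemma conjs_uniq (a b c e : algC) :
  a \in Crat -> b \in Crat -> c \in Crat -> e \in Crat -> (c != 0) || (e != 0) ->
  uniq (conjs a b c e).
Proof.
move=> a_rat b_rat c_rat e_rat ce_neq0.
have neq (b' c' e' : algC) : b' \in Crat -> c' \in Crat -> e' \in Crat ->
    (c' = 0 -> e' = 0 -> c = 0 /\ e = 0) -> elt 0 b' c' e' s t u != 0.
  move=> b'_rat c'_rat e'_rat h; apply/eqP => E0.
  have [_ _ c0 e0] := elt_indep Crat0 b'_rat c'_rat e'_rat E0.
  by have [c00 e00] := h c0 e0; move: ce_neq0; rewrite c00 e00 eqxx.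
have two0 (x : algC) : 2 * x = 0 -> x = 0.
  by move=> /eqP; rewrite mulf_eq0 pnatr_eq0 => /eqP.
have sum0 : c + e = 0 -> e - c = 0 -> c = 0 /\ e = 0.
  move=> h1 /subr0_eq h2; have c0 : c = 0 by apply: two0; rewrite mulr_natl mulr2n -{2}h2.
  by rewrite h2 c0.
have dif0 : c - e = 0 -> e + c = 0 -> c = 0 /\ e = 0.
  move=> /subr0_eq -> h; have e0 : e = 0 by apply: two0; rewrite mulr_natl mulr2n.
  by rewrite e0.
rewrite /conjs uniq4; apply/and5P; split; last (apply/andP; split); rewrite -subr_eq0.
- rewrite (_ : _ - _ = elt 0 0 (2 * c) (2 * e) s t u); last by rewrite /elt; ring.
  by apply: neq; [crat|crat|crat|move=> /two0 -> /two0].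
- rewrite (_ : _ - _ = elt 0 (2 * b) (c + e) (e - c) s t u); last by rewrite /elt; ring.
  by apply: neq; [crat|crat|crat|].
- rewrite (_ : _ - _ = elt 0 (2 * b) (c - e) (e + c) s t u); last by rewrite /elt; ring.
  by apply: neq; [crat|crat|crat|].
- rewrite (_ : _ - _ = elt 0 (2 * b) (- (c - e)) (- (e + c)) s t u); last by rewrite /elt; ring.
  by apply: neq; [crat|crat|crat|] => /eqP + /eqP; rewrite !oppr_eq0 => /eqP + /eqP.
- rewrite (_ : _ - _ = elt 0 (2 * b) (- (c + e)) (- (e - c)) s t u); last by rewrite /elt; ring.
  by apply: neq; [crat|crat|crat|] => /eqP + /eqP; rewrite !oppr_eq0 => /eqP + /eqP.
- rewrite (_ : _ - _ = elt 0 0 (- (2 * e)) (2 * c) s t u); last by rewrite /elt; ring.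
  by apply: neq; [crat|crat|crat|move=> /eqP; rewrite oppr_eq0 => /eqP /two0 -> /two0].
Qed.

(** The product divides the minimal polynomial because its roots are distinct conjugates; it is
    divisible by it because it is rational by [quartic_prod]. *)
Lemma minCpoly_elt (a b c e : algC) :
  a \in Crat -> b \in Crat -> c \in Crat -> e \in Crat -> (c != 0) || (e != 0) ->
  minCpoly (elt a b c e s t u) = \prod_(r <- conjs a b c e) ('X - r%:P).
Proof.
move=> a_rat b_rat c_rat e_rat ce_neq0.
have [p [Dp p_monic] p_min] := minCpolyP (elt a b c e s t u).
have prod_dvd : \prod_(r <- conjs a b c e) ('X - r%:P) %| minCpoly (elt a b c e s t u).
  apply: uniq_roots_dvdp; last by rewrite uniq_rootsE conjs_uniq.
  apply/allP; apply: conjs_rel => s' t' u' rel'; rewrite Dp; apply: conj_root => //.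
  by rewrite /ratp -Dp root_minCpoly.
case/CratP: (a_rat) => a' Da; case/CratP: (b_rat) => b' Db.
case/CratP: (c_rat) => c' Dc; case/CratP: (e_rat) => e' De.
have [q Dq] : exists q, ratp q = \prod_(r <- conjs a b c e) ('X - r%:P).
  exists ((('X - a'%:P) ^+ 2 + (b'%:P ^+ 2 - c'%:P ^+ 2 - e'%:P ^+ 2) * (k%:R%:P ^+ 2 + 1%:P)) ^+ 2
    - (k%:R%:P ^+ 2 + 1%:P) * (2%:R%:P * b'%:P * ('X - a'%:P) + c'%:P ^+ 2 - e'%:P ^+ 2
        + 2%:R%:P * c'%:P * e'%:P * k%:R%:P) ^+ 2).
  have [ss _ _ [tt tu uu]] := theta_rel.
  have ssP : s%:P * s%:P = K%:P ^+ 2 + 1 by rewrite -polyCM ss polyCD polyC_exp.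
  have ttP : t%:P * t%:P = s%:P * s%:P + s%:P by rewrite -!polyCM tt polyCD.
  have tuP : t%:P * u%:P = K%:P * s%:P by rewrite -!polyCM tu.
  have uuP : u%:P * u%:P = s%:P * s%:P - s%:P by rewrite -!polyCM uu polyCB.
  have E := quartic_prod 'X a%:P b%:P c%:P e%:P ssP ttP tuP uuP.
  rewrite !ratpE !ratr_nat -Da -Db -Dc -De rmorph1 polyC1 -/K (polyC_natr _ 2).
  rewrite /conjs !big_cons big_nil mulr1 mulrA !polyC_elt !polyCN.
  by rewrite -E; ring.
have q_root : root (ratp q) (elt a b c e s t u).
  by rewrite Dq /conjs big_cons rootM root_XsubC eqxx.
apply/eqP; rewrite -eqp_monic ?minCpoly_monic ?monic_prod_XsubC //.
by rewrite /eqp prod_dvd -Dq Dp -[map_poly ratr p]/(ratp p) dvdp_map -p_min q_root.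
Qed.

(** * The ring of integers *)

Lemma s_Aint : s \in Aint.
Proof. by apply: Aint_sqr; rewrite expr2 s_sqr; crat. Qed.

Lemma t_Aint : t \in Aint.
Proof. by apply: Aint_sqr; rewrite expr2 t_sqr s_sqr; have := s_Aint => ?; crat. Qed.

Lemma u_Aint : u \in Aint.
Proof.
have [_ _ _ [_ _ uu]] := theta_rel.
by apply: Aint_sqr; rewrite expr2 uu s_sqr; have := s_Aint => ?; crat.
Qed.

(** For [k = 2 h] this is a root of [X^2 - X - h^2]. *)
Lemma half_Aint : ~~ odd k -> (1 + s) / 2 \in Aint.
Proof.
move=> k_even; pose h : algC := (k./2)%:R.
have Dk : K = 2 * h by rewrite /K -[in LHS](odd_double_half k) (negPf k_even) -muln2 natrM mulrC.
apply: (@root_monic_Aint ('X^2 - ('X + (h ^+ 2)%:P))).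
- rewrite /root !hornerE; apply/eqP.
  by apply: (@lincomb1 _ 4 1 _ _ _ _ _ s_sqr); rewrite ?pnatr_eq0 // Dk; field.
- rewrite monicE lead_coefDl ?lead_coefXn // size_polyXn size_polyN.
  by apply: leq_ltn_trans (size_polyD _ _) _; rewrite size_polyX size_polyC; case: (_ != 0).
apply/polyOverP => i; rewrite coefB coefD coefXn coefX coefC.
by case: (i == 0); crat.
Qed.

Lemma rat_mul_s_int (r : algC) : r \in Crat -> r * s \in Aint -> r \in Num.int.
Proof.
move=> r_rat rs_int; apply: (squarefree_sqr_int sqf_k) => //.
rewrite natr_sqrS -/K -s_sqr; apply: Cint_rat_Aint.
  by rewrite s_sqr; crat.
by rewrite expr2 mulrACA rpredM.
Qed.

(* Coordinates with respect to the integral basis [1, w, t, u], where [w = s] for odd [k]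
   and [w = (1 + s) / 2] for even [k]. *)
Definition coord1 (A B : int) : algC := if odd k then A%:~R else A%:~R + B%:~R / 2.
Definition coord2 (B : int) : algC := if odd k then B%:~R else B%:~R / 2.

Definition int_elt (A B C E : int) : algC :=
  elt (coord1 A B) (coord2 B) C%:~R E%:~R s t u.

Lemma coord1_rat (A B : int) : coord1 A B \in Crat.
Proof. by rewrite /coord1; case: (odd k); crat; apply: rpred_int. Qed.

Lemma coord2_rat (B : int) : coord2 B \in Crat.
Proof. by rewrite /coord2; case: (odd k); crat; apply: rpred_int. Qed.

Lemma int_elt_Aint (A B C E : int) : int_elt A B C E \in Aint.
Proof.
have := s_Aint => hs; have := t_Aint => ht; have := u_Aint => hu.
have intA n : n%:~R \in Aint by apply: Aint_int.
rewrite /int_elt /elt /coord1 /coord2; case: (boolP (odd k)) => [_|/half_Aint hw].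
  by crat.
have -> : A%:~R + B%:~R / 2 + B%:~R / 2 * s = A%:~R + B%:~R * ((1 + s) / 2) by field.
by crat.
Qed.

(** Combinations of the four conjugates lying in Q or in Q times [s] are algebraic integers, which
    makes their rational coefficients integers. Parity considerations then remove the remaining
    denominators. *)
Lemma integral_elt (a b c e : algC) :
  a \in Crat -> b \in Crat -> c \in Crat -> e \in Crat -> elt a b c e s t u \in Aint ->
  exists A B C E : int, [/\ a = coord1 A B, b = coord2 B, c = C%:~R & e = E%:~R].
Proof.
move=> a_rat b_rat c_rat e_rat x1_int.
have rel := theta_rel; have [ss st su [tt tu uu]] := rel.
have x2_int := conj_Aint a_rat b_rat c_rat e_rat (quartic_rel_neg rel) x1_int.
have x3_int := conj_Aint a_rat b_rat c_rat e_rat (quartic_rel_rot rel) x1_int.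
have x4_int := conj_Aint a_rat b_rat c_rat e_rat (quartic_rel_rot3 rel) x1_int.
set x1 := elt _ _ _ _ s t u in x1_int; set x2 := elt _ _ _ _ _ _ _ in x2_int.
set x3 := elt _ _ _ _ _ _ _ in x3_int; set x4 := elt _ _ _ _ _ _ _ in x4_int.
(* [g] and [g'] are half the differences within the pairs conjugate over Q(s). *)
pose g := c * t + e * u; pose g' := c * u - e * t.
have Dx1 : x1 = a + b * s + g by rewrite /x1 /elt /g; ring.
have Dx2 : x2 = a + b * s - g by rewrite /x2 /elt /g; ring.
have Dx3 : x3 = a - b * s + g' by rewrite /x3 /elt /g'; ring.
have Dx4 : x4 = a - b * s - g' by rewrite /x4 /elt /g'; ring.
pose v := c ^+ 2 - e ^+ 2 + 2 * c * e * K.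
have gg : g * g = (K ^+ 2 + 1) * (c ^+ 2 + e ^+ 2) + v * s.
  transitivity (c ^+ 2 * (t * t) + e ^+ 2 * (u * u) + 2 * c * e * (t * u)).
    by rewrite /g; ring.
  by rewrite tt uu tu -ss /v; ring.
have gg' : g' * g' = (K ^+ 2 + 1) * (c ^+ 2 + e ^+ 2) - v * s.
  transitivity (c ^+ 2 * (u * u) + e ^+ 2 * (t * t) - 2 * c * e * (t * u)).
    by rewrite /g'; ring.
  by rewrite tt uu tu -ss /v; ring.
have ggx : g * g' = (K * (c ^+ 2 - e ^+ 2) - 2 * c * e) * s.
  transitivity ((c ^+ 2 - e ^+ 2) * (t * u) + c * e * (u * u - t * t)).
    by rewrite /g /g'; ring.
  by rewrite tt uu tu; ring.
have v_rat : v \in Crat by rewrite /v; crat.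
have isint (r x : algC) : r \in Crat -> x \in Aint -> x = r -> exists n : int, r = n%:~R.
  by move=> r_rat x_int Dr; apply/intrP; apply: Cint_rat_Aint; rewrite -?Dr // Dr.
have isints (r x : algC) : r \in Crat -> x \in Aint -> x = r * s -> exists n : int, r = n%:~R.
  by move=> r_rat x_int Dr; apply/intrP; apply: rat_mul_s_int; rewrite -?Dr.
have [A DA] : exists n : int, 4 * a = n%:~R.
  by apply: (isint _ (x1 + x2 + x3 + x4)); [crat | crat | rewrite Dx1 Dx2 Dx3 Dx4; ring].
have [B DB] : exists n : int, 4 * b = n%:~R.
  by apply: (isints _ (x1 + x2 - x3 - x4)); [crat | crat | rewrite Dx1 Dx2 Dx3 Dx4; ring].
have [n1 Dn1] : exists n : int, 4 * a ^+ 2 - 4 * b ^+ 2 * (K ^+ 2 + 1) = n%:~R.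
  apply: (isint _ ((x1 + x2) * (x3 + x4))); [by crat | by crat |].
  by rewrite Dx1 Dx2 Dx3 Dx4 -ss; ring.
have [T DT] : exists n : int, 8 * (K ^+ 2 + 1) * (c ^+ 2 + e ^+ 2) = n%:~R.
  apply: (isint _ ((x1 - x2) * (x1 - x2) + (x3 - x4) * (x3 - x4))); [by crat | by crat |].
  transitivity (4 * (g * g) + 4 * (g' * g')); first by rewrite Dx1 Dx2 Dx3 Dx4; ring.
  by rewrite gg gg'; ring.
have [y Dy] : exists n : int, 4 * (K * (c ^+ 2 - e ^+ 2) - 2 * c * e) = n%:~R.
  apply: (isints _ ((x1 - x2) * (x3 - x4))); [by crat | by crat |].
  transitivity (4 * (g * g')); first by rewrite Dx1 Dx2 Dx3 Dx4; ring.
  by rewrite ggx; ring.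
have [z Dz] : exists n : int, 8 * v = n%:~R.
  apply: (isints _ ((x1 - x2) * (x1 - x2) - (x3 - x4) * (x3 - x4))); [by crat | by crat |].
  transitivity (4 * (g * g) - 4 * (g' * g')); first by rewrite Dx1 Dx2 Dx3 Dx4; ring.
  by rewrite gg gg'; ring.
have [U DU] : exists n : int, 2 * (a ^+ 2 + (b ^+ 2 - c ^+ 2 - e ^+ 2) * (K ^+ 2 + 1)) = n%:~R.
  apply: (isint _ (x1 * x2 + x3 * x4)); [by crat | by crat |].
  transitivity (2 * (a ^+ 2 + b ^+ 2 * (s * s)) - g * g - g' * g').
    by rewrite Dx1 Dx2 Dx3 Dx4; ring.
  by rewrite gg gg' ss; ring.
have [V DV] : exists n : int, 4 * a * b - 2 * v = n%:~R.
  apply: (isints _ (x1 * x2 - x3 * x4)); [by crat | by crat |].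
  transitivity (4 * a * b * s - g * g + g' * g').
    by rewrite Dx1 Dx2 Dx3 Dx4; ring.
  by rewrite gg gg'; ring.
have [n2 Dn2] : exists n : int,
    ((U%:~R) ^+ 2 - (K ^+ 2 + 1) * (V%:~R) ^+ 2) / 4 = n%:~R.
  have Urat n : n%:~R \in Crat by apply: rpred_int.
  apply: (isint _ (x1 * x2 * (x3 * x4))); [by crat | by crat |].
  have -> : x1 * x2 = (U%:~R + V%:~R * s) / 2.
    transitivity (a ^+ 2 + b ^+ 2 * (s * s) + 2 * a * b * s - g * g).
      by rewrite Dx1 Dx2; ring.
    by rewrite gg ss -DU -DV; field.
  have -> : x3 * x4 = (U%:~R - V%:~R * s) / 2.
    transitivity (a ^+ 2 + b ^+ 2 * (s * s) - 2 * a * b * s - g' * g').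
      by rewrite Dx3 Dx4; ring.
    by rewrite gg' ss -DU -DV; field.
  by rewrite -ss; field.
have sq4 (w : algC) (n : int) : w \in Crat -> 16 * w ^+ 2 * (K ^+ 2 + 1) = n%:~R ->
    exists m : int, 4 * w = m%:~R.
  move=> w_rat Dw; apply/intrP; apply: (squarefree_sqr_int sqf_k); first by crat.
  by rewrite natr_sqrS (_ : _ * _ = n%:~R) ?intr_int // -Dw; ring.
(* As [z + 2 y K = 8 (K^2 + 1) (c^2 - e^2)], adding it to [T] leaves [16 c^2 (K^2 + 1)], and
   subtracting it leaves the same with [e]. *)
have [C4 DC4] : exists m : int, 4 * c = m%:~R.
  apply: (sq4 _ (T + (z + 2 * y * k%:Z))) => //.
  transitivity (T%:~R + (z%:~R + 2 * y%:~R * K)); last by rewrite /K; ring.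
  by rewrite -DT -Dz -Dy /v; ring.
have [E4 DE4] : exists m : int, 4 * e = m%:~R.
  apply: (sq4 _ (T - (z + 2 * y * k%:Z))) => //.
  transitivity (T%:~R - (z%:~R + 2 * y%:~R * K)); last by rewrite /K; ring.
  by rewrite -DT -Dz -Dy /v; ring.
have inj (i j : int) : i%:~R = j%:~R :> algC -> i = j by apply: intr_inj.
have [[C DC] [E DE]] : (exists C', C4 = 2 * C') /\ (exists E', E4 = 2 * E').
  apply: (@even_coords_of_trace k%:Z _ _ y z); apply: inj.
    transitivity (K * (C4%:~R ^+ 2 - E4%:~R ^+ 2) - 2 * C4%:~R * E4%:~R); first by rewrite /K; ring.
    by rewrite [RHS]rmorphM /= -Dy -DC4 -DE4; ring.
  transitivity (C4%:~R ^+ 2 - E4%:~R ^+ 2 + 2 * C4%:~R * E4%:~R * K); first by rewrite /K; ring.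
  by rewrite [RHS]rmorphM /= -Dz -DC4 -DE4 /v; ring.
have Dc : c = C%:~R / 2.
  by apply: (@lincomb1 _ 4 1 _ _ _ _ _ DC4); rewrite ?pnatr_eq0 // DC; field.
have De : e = E%:~R / 2.
  by apply: (@lincomb1 _ 4 1 _ _ _ _ _ DE4); rewrite ?pnatr_eq0 // DE; field.
have Da : a = A%:~R / 4 by rewrite -DA; field.
have Db : b = B%:~R / 4 by rewrite -DB; field.
have hN : A ^+ 2 - (k%:Z ^+ 2 + 1) * B ^+ 2 = 4 * n1.
  apply: inj; transitivity (A%:~R ^+ 2 - (K ^+ 2 + 1) * B%:~R ^+ 2); first by rewrite /K; ring.
  by rewrite [RHS]rmorphM /= -Dn1 -DA -DB; ring.
have hU : A ^+ 2 + (k%:Z ^+ 2 + 1) * B ^+ 2 - 4 * (k%:Z ^+ 2 + 1) * (C ^+ 2 + E ^+ 2) = 8 * U.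
  apply: inj; transitivity (A%:~R ^+ 2 + (K ^+ 2 + 1) * B%:~R ^+ 2
    - 4 * (K ^+ 2 + 1) * (C%:~R ^+ 2 + E%:~R ^+ 2)); first by rewrite /K; ring.
  by rewrite [RHS]rmorphM /= -DU Dc De Da Db; field.
have hV : A * B - 2 * (C ^+ 2 - E ^+ 2 + 2 * C * E * k%:Z) = 4 * V.
  apply: inj; transitivity (A%:~R * B%:~R
    - 2 * (C%:~R ^+ 2 - E%:~R ^+ 2 + 2 * C%:~R * E%:~R * K)); first by rewrite /K; ring.
  by rewrite [RHS]rmorphM /= -DV /v Dc De Da Db; field.
have hUV : U ^+ 2 - (k%:Z ^+ 2 + 1) * V ^+ 2 = 4 * n2.
  apply: inj; transitivity (U%:~R ^+ 2 - (K ^+ 2 + 1) * V%:~R ^+ 2); first by rewrite /K; ring.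
  by rewrite [RHS]rmorphM /= -Dn2; field.
rewrite /coord1 /coord2; case: (boolP (odd k)) => k_odd.
  have Dk : k%:Z = 2 * (k./2)%:Z + 1 by rewrite [LHS]half_int k_odd.
  rewrite Dk in hN hU hV hUV.
  have [a' [b' [c' [e' [EA EB EC EE]]]]] := integral_coords_odd hN hU hV hUV.
  by exists a', b', c', e'; split; rewrite ?Da ?Db ?Dc ?De ?EA ?EB ?EC ?EE; field.
have Dk : k%:Z = 2 * (k./2)%:Z by rewrite [LHS]half_int (negPf k_odd) addr0.
rewrite Dk in hN hU hV hUV.
have [a' [b' [c' [e' [EA EB EC EE]]]]] := integral_coords_even hN hU hV hUV.
by exists a', b', c', e'; split; rewrite ?Da ?Db ?Dc ?De ?EA ?EB ?EC ?EE; field.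
Qed.

(** * Generators of the field *)

(** Squaring [x - a - b s = g] gives an equation linear in [s] over Q(x), hence [s]; then
    [K g = t (K c - e + e s)] gives [t]. *)
Lemma theta_in_Qgen (a b c e : algC) :
  a \in Crat -> b \in Crat -> c \in Crat -> e \in Crat -> (c != 0) || (e != 0) ->
  inQgen (elt a b c e s t u) t.
Proof.
move=> a_rat b_rat c_rat e_rat ce_neq0; set x := elt a b c e s t u.
have [ss st su [tt tu uu]] := theta_rel.
pose g := c * t + e * u; pose v := c ^+ 2 - e ^+ 2 + 2 * c * e * K.
have Dx : x = a + b * s + g by rewrite /x /elt /g; ring.
have gg : g * g = (K ^+ 2 + 1) * (c ^+ 2 + e ^+ 2) + v * s.
  transitivity (c ^+ 2 * (t * t) + e ^+ 2 * (u * u) + 2 * c * e * (t * u)).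
    by rewrite /g; ring.
  by rewrite tt uu tu -ss /v; ring.
have v_rat : v \in Crat by rewrite /v; crat.
have xQ := inQgen_id x.
have Q r : r \in Crat -> inQgen x r := @inQgen_Crat x r.
have den_neq0 : 2 * b * (x - a) + v != 0.
  apply/eqP => den0.
  have : elt v (2 * b ^+ 2) (2 * b * c) (2 * b * e) s t u = 0.
    by rewrite -[RHS]den0 Dx /g /elt; ring.
  case/elt_indep; [by crat | by crat | by crat | by crat |] => v0 _ _ _.
  case: (eqVneq e 0) => [e0|e_neq0].
    move: v0 ce_neq0; rewrite /v e0 eqxx orbF expr0n /= subr0 mulr0 mul0r addr0 => /eqP.
    by rewrite expf_eq0 /= => ->.
  (* [v = 0] amounts to [(c + e K)^2 = e^2 (K^2 + 1)]. *)
  have /negP[] := @sqrt_irrational ((c + e * K) / e) ltac:(crat).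
  rewrite expr_div_n; apply/eqP.
  apply: (@lincomb1 _ (e ^+ 2) 1 _ _ _ _ (expf_neq0 2 e_neq0) v0).
  by rewrite mulrBr mulrCA divff ?expf_neq0 // /v; ring.
have sQ : inQgen x s.
  have -> : s = ((x - a) * (x - a) + (b ^+ 2 - c ^+ 2 - e ^+ 2) * (K ^+ 2 + 1))
                 / (2 * b * (x - a) + v).
    apply: (mulIf den_neq0); rewrite divfK //.
    transitivity (2 * b ^+ 2 * (s * s) + 2 * b * s * g + v * s); first by rewrite Dx; ring.
    transitivity (b ^+ 2 * (s * s) + 2 * b * s * g + g * g
        + (b ^+ 2 - c ^+ 2 - e ^+ 2) * (K ^+ 2 + 1)); last by rewrite Dx; ring.
    by rewrite gg ss; ring.
  apply: inQgenM.
    by apply: inQgenD; [apply: inQgenM; apply: inQgenB => //; apply: Q | apply: Q; crat].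
  apply: inQgenV; apply: inQgenD; last exact: Q.
  by apply: inQgenM; [apply: Q; crat | apply: inQgenB => //; apply: Q].
have w_neq0 : K * c - e + e * s != 0.
  apply/eqP => /quadratic_indep []; [by crat | by crat |] => /subr0_eq Kc e0.
  move: ce_neq0; rewrite e0 eqxx orbF.
  by move/eqP: Kc; rewrite e0 mulf_eq0 (negPf K_neq0) /= => ->.
have -> : t = K * (x - a - b * s) / (K * c - e + e * s).
  apply: (mulIf w_neq0); rewrite divfK //.
  transitivity (c * K * t + e * (K * u)); last by rewrite Dx /g; ring.
  by apply: (@lincomb1 _ 1 e _ _ _ _ (oner_neq0 _) st); ring.
apply: inQgenM.
  apply: inQgenM; first exact: Q.
  apply: inQgenB; first by apply: inQgenB => //; apply: Q.
  by apply: inQgenM => //; apply: Q.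
apply: inQgenV; apply: inQgenD; first by apply: Q; crat.
by apply: inQgenM => //; apply: Q.
Qed.

Lemma inQgen_quadratic (a b y : algC) : a \in Crat -> b \in Crat ->
  inQgen (a + b * s) y -> exists a' b', [/\ a' \in Crat, b' \in Crat & y = a' + b' * s].
Proof.
move=> a_rat b_rat [q ->].
elim/poly_ind: q => [|q r [a' [b' [a'_rat b'_rat Dq]]]].
  by exists 0, 0; rewrite !rpred0 /ratp rmorph0 horner0 mul0r addr0.
have r_rat := Crat_rat r.
exists (a' * a + b' * b * (K ^+ 2 + 1) + ratr r), (a' * b + b' * a); split; [by crat|by crat|].
by rewrite !ratpE !hornerE Dq -s_sqr; ring.
Qed.

(** When [c = e = 0] the element generates a subfield of Q(s), which does not contain [t]. *)
Lemma generates_elt (a b c e : algC) :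
  a \in Crat -> b \in Crat -> c \in Crat -> e \in Crat ->
  generates t (elt a b c e s t u) <-> (c != 0) || (e != 0).
Proof.
move=> a_rat b_rat c_rat e_rat; split=> [gen|ce_neq0 y].
  apply/negPn/negP; rewrite negb_or !negbK => /andP [/eqP c0 /eqP e0].
  have /gen := inQgen_id t; rewrite /elt c0 e0 !mul0r !addr0.
  case/inQgen_quadratic => // a' [b' [a'_rat b'_rat /eqP]].
  by apply/negP; apply: theta_notin_quadratic.
split; apply: inQgen_trans; first exact: theta_in_Qgen.
by apply/inQgen_eltP; exists a, b, c, e.
Qed.

(** * Mahler measures of integral generators *)

Definition mahler_int (A B C E : int) : algC :=
  \prod_(r <- conjs (coord1 A B) (coord2 B) C%:~R E%:~R) max1 r.

Lemma int_neq0 (C E : int) :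
  ((C%:~R : algC) != 0) || ((E%:~R : algC) != 0) = (C != 0) || (E != 0).
Proof. by rewrite !intr_eq0. Qed.

Lemma mahler_int_elt (A B C E : int) (m : algC) : (C != 0) || (E != 0) ->
  mahler_alg (int_elt A B C E) m <-> m = mahler_int A B C E.
Proof.
move=> CE_neq0.
rewrite (@mahler_alg_Aint _ m (conjs (coord1 A B) (coord2 B) C%:~R E%:~R)).
- by rewrite big_mkcond.
- exact: int_elt_Aint.
- by apply: minCpoly_elt; rewrite ?coord1_rat ?coord2_rat ?rpred_int ?int_neq0.
Qed.

Lemma int_elt_generator (A B C E : int) : (C != 0) || (E != 0) ->
  inOK t (int_elt A B C E) /\ generates t (int_elt A B C E).
Proof.
move=> CE_neq0; split.
  split; last exact: int_elt_Aint.
  apply/inQgen_eltP; exists (coord1 A B), (coord2 B), C%:~R, E%:~R.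
  by rewrite coord1_rat coord2_rat !rpred_int.
by apply/generates_elt; rewrite ?coord1_rat ?coord2_rat ?rpred_int ?int_neq0.
Qed.

Lemma generator_int_elt (x : algC) : inOK t x -> generates t x ->
  exists A B C E : int, ((C != 0) || (E != 0)) /\ x = int_elt A B C E.
Proof.
case=> /inQgen_eltP [a [b [c [e [[a_rat b_rat c_rat e_rat] ->]]]]] x_int.
have [A [B [C [E [-> -> -> ->]]]]] := integral_elt a_rat b_rat c_rat e_rat x_int.
move/generates_elt; rewrite int_neq0 ?coord1_rat ?coord2_rat ?rpred_int // => /(_ isT isT isT isT) nz.
by exists A, B, C, E.
Qed.

Lemma mahler_intE (A B C E : int) : mahler_int A B C E =
  max1 (elt (coord1 A B) (coord2 B) C%:~R E%:~R s t u)
  * max1 (elt (coord1 A B) (coord2 B) C%:~R E%:~R s (- t) (- u))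
  * (max1 (elt (coord1 A B) (coord2 B) C%:~R E%:~R (- s) u (- t))
  * max1 (elt (coord1 A B) (coord2 B) C%:~R E%:~R (- s) (- u) t)).
Proof. by rewrite /mahler_int /conjs !big_cons big_nil mulr1 mulrA. Qed.

Lemma norm_le_mahler_int (A B C E : int) (x : algC) :
  x \in conjs (coord1 A B) (coord2 B) C%:~R E%:~R -> `|x| <= mahler_int A B C E.
Proof.
move=> x_in; apply: le_trans (max1_ge_norm x) _.
have prod_ge1 (l : seq algC) : 1 <= \prod_(r <- l) max1 r.
  by elim/big_ind: _ => // [y z y_ge1 z_ge1|r _]; [apply: mulr_ege1 | apply: max1_ge1].
rewrite /mahler_int (perm_big _ (perm_to_rem x_in)) /= big_cons.
by rewrite ler_peMr ?max1_ge0 ?prod_ge1.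
Qed.

Lemma mahler_int_ge0 (A B C E : int) : 0 <= mahler_int A B C E.
Proof. by rewrite mahler_intE !mulr_ge0 ?max1_ge0. Qed.

Lemma K_gt0 : 0 < K.
Proof. by rewrite ltr0n. Qed.

Lemma K_lt_s : K < s.
Proof.
rewrite -ltr_sqr ?nnegrE ?(ltW K_gt0) ?(ltW s_gt0) // [s ^+ 2]expr2 s_sqr.
by rewrite ltrDl ltr01.
Qed.

Lemma s_ge1 : 1 <= s.
Proof. by apply: le_trans (ltW K_lt_s); rewrite ler1n. Qed.

Lemma t_ge0 : 0 <= t.
Proof. by rewrite sqrtC_ge0 addr_ge0 ?ler0n ?(ltW s_gt0). Qed.

Lemma u_ge0 : 0 <= u.
Proof. by rewrite !mulr_ge0 ?invr_ge0 ?(ltW K_gt0) ?t_ge0 // subr_ge0 s_ge1. Qed.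

Lemma t_le_2s : t <= 2 * s.
Proof.
have s_ge0 := ltW s_gt0.
rewrite -ler_sqr ?nnegrE ?t_ge0 ?mulr_ge0 // [t ^+ 2]expr2 t_sqr.
have -> : (2 * s) ^+ 2 = s * s + (3 * (s * s)) by ring.
rewrite lerD2l; apply: le_trans (_ : s * s <= _); first by rewrite ler_peMr ?s_ge1.
by rewrite ler_peMl ?mulr_ge0 // ler1n.
Qed.

Lemma u_le_2s : u <= 2 * s.
Proof.
have s_ge0 := ltW s_gt0; have [_ _ _ [_ _ uu]] := theta_rel.
rewrite -ler_sqr ?nnegrE ?u_ge0 ?mulr_ge0 // [u ^+ 2]expr2 uu.
have -> : (2 * s) ^+ 2 = s * s + (3 * (s * s)) by ring.
by rewrite lerD2l (le_trans (_ : _ <= 0)) ?oppr_le0 ?mulr_ge0.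
Qed.

(** Each coordinate is a combination of the conjugates, all bounded by the measure. The factor 2
    covers both the size of [t] and [u] and the half-integral coordinates for even [k]. *)
Lemma int_coord_bound (A B C E : int) :
  [/\ `|A%:~R| <= 2 * mahler_int A B C E, `|B%:~R| <= 2 * mahler_int A B C E,
      `|C%:~R| <= 2 * mahler_int A B C E & `|E%:~R| <= 2 * mahler_int A B C E].
Proof.
have [ss _ _ [tt tu uu]] := theta_rel.
set M := mahler_int A B C E.
have M_ge0 : 0 <= M := mahler_int_ge0 A B C E.
have s_ge0 := ltW s_gt0.
pose a := coord1 A B; pose b := coord2 B; pose c : algC := C%:~R; pose e : algC := E%:~R.
pose x1 := elt a b c e s t u; pose x2 := elt a b c e s (- t) (- u).
pose x3 := elt a b c e (- s) u (- t); pose x4 := elt a b c e (- s) (- u) t.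
have h1 : `|x1| <= M by apply: norm_le_mahler_int; rewrite !inE eqxx.
have h2 : `|x2| <= M by apply: norm_le_mahler_int; rewrite !inE eqxx ?orbT.
have h3 : `|x3| <= M by apply: norm_le_mahler_int; rewrite !inE eqxx ?orbT.
have h4 : `|x4| <= M by apply: norm_le_mahler_int; rewrite !inE eqxx ?orbT.
have four_gt0 : 0 < 4 :> algC by rewrite ltr0n.
have sum4 (y1 y2 y3 y4 z w : algC) : `|y1| <= w -> `|y2| <= w -> `|y3| <= w -> `|y4| <= w ->
    4 * z = y1 + y2 + y3 + y4 -> `|z| <= w.
  move=> k1 k2 k3 k4 Dz; rewrite -(ler_pM2l four_gt0) -{1}(gtr0_norm four_gt0) -normrM Dz.
  have -> : 4 * w = w + w + w + w by ring.
  by do 3!(apply: le_trans (ler_normD _ _) _; apply: lerD => //).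
have ha : `|a| <= M.
  by apply: (sum4 x1 x2 x3 x4) => //; rewrite /x1 /x2 /x3 /x4 /elt; ring.
have hb : `|b| <= M.
  apply: le_trans (_ : `|b * s| <= M).
    by rewrite normrM ler_peMr // (ger0_norm s_ge0) s_ge1.
  apply: (sum4 x1 x2 (- x3) (- x4)); rewrite ?normrN //.
  by rewrite /x1 /x2 /x3 /x4 /elt; ring.
have ss_gt0 : 0 < s * s by rewrite mulr_gt0 ?s_gt0.
have bound2 (y z : algC) : `|y| <= M -> 0 <= z -> z <= 2 * s -> `|y * z| <= 2 * M * (s * s).
  move=> hy z_ge0 hz; rewrite normrM (ger0_norm z_ge0) (mulrC 2) -mulrA.
  apply: ler_pM => //; apply: le_trans hz _.
  by rewrite ler_wpM2l // ler_peMr ?s_ge1.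
have t0 := t_ge0; have u0 := u_ge0; have t2 := t_le_2s; have u2 := u_le_2s.
have normz (z : algC) : `|z * (s * s)| <= 2 * M * (s * s) -> `|z| <= 2 * M.
  by rewrite normrM (gtr0_norm ss_gt0) ler_pM2r.
have hc : `|c| <= 2 * M.
  (* The sum is [2 c (t^2 + u^2) = 4 c s^2]; each term is at most [2 M s^2], because [t] and [u] are
     at most [2 s] and [s >= 1]. *)
  apply: normz; apply: (sum4 (x1 * t) (- x2 * t) (x3 * u) (- x4 * u));
    try by apply: bound2; rewrite ?normrN.
  transitivity (2 * c * (t * t + u * u)); last by rewrite /x1 /x2 /x3 /x4 /elt; ring.
  by rewrite tt uu; ring.
have he : `|e| <= 2 * M.
  apply: normz; apply: (sum4 (x1 * u) (- x2 * u) (- x3 * t) (x4 * t));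
    try by apply: bound2; rewrite ?normrN.
  transitivity (2 * e * (t * t + u * u)); last by rewrite /x1 /x2 /x3 /x4 /elt; ring.
  by rewrite tt uu; ring.
have M2 : 2 * M = M + M by ring.
split=> //; rewrite M2; move: ha hb; rewrite /a /b /coord1 /coord2; case: (odd k) => ha hb.
- by rewrite (le_trans ha) // lerDl.
- have -> : A%:~R = (A%:~R + B%:~R / 2) - B%:~R / 2 :> algC by ring.
  by apply: le_trans (ler_normB _ _) _; apply: lerD.
- by rewrite (le_trans hb) // lerDl.
have -> : B%:~R = B%:~R / 2 + B%:~R / 2 :> algC by field.
by apply: le_trans (ler_normD _ _) _; apply: lerD.
Qed.

(* Writing [x_i] for the conjugates, [(x_1 - x_2) (x_3 - x_4)] is [4 s] times a nonzero integer,
   and is at most [4 M(x)] in absolute value. *)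
Lemma mahler_int_ge (A B C E : int) : (C != 0) || (E != 0) -> s <= mahler_int A B C E.
Proof.
move=> CE_neq0; have [ss _ _ [tt tu uu]] := theta_rel.
have := @conjs_uniq (coord1 A B) (coord2 B) C%:~R E%:~R.
rewrite coord1_rat coord2_rat !rpred_int !intr_eq0 => /(_ isT isT isT isT CE_neq0).
rewrite mahler_intE /conjs.
set x1 := elt _ _ _ _ s t u; set x2 := elt _ _ _ _ s (- t) (- u).
set x3 := elt _ _ _ _ (- s) u (- t); set x4 := elt _ _ _ _ (- s) (- u) t.
rewrite uniq4 => /and5P [x12 _ _ _ /andP [_ x34]].
pose n : int := k%:Z * (C ^+ 2 - E ^+ 2) - 2 * C * E.
have Dn : (x1 - x2) * (x3 - x4) = 4 * (n%:~R * s).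
  transitivity (4 * ((C%:~R ^+ 2 - E%:~R ^+ 2) * (t * u) + C%:~R * E%:~R * (u * u - t * t))).
    by rewrite /x1 /x2 /x3 /x4 /elt; ring.
  by rewrite tt uu tu /n /K; ring.
have n_neq0 : n != 0.
  apply: contraNneq x12 => n0; move/eqP: Dn; rewrite n0 mul0r mulr0 mulf_eq0 !subr_eq0.
  by rewrite (negPf x34) orbF.
have : 4 * s <= 4 * (max1 x1 * max1 x2 * (max1 x3 * max1 x4)).
  apply: le_trans (_ : `|(x1 - x2) * (x3 - x4)| <= _).
    rewrite Dn !normrM (gtr0_norm s_gt0) normr_nat ler_pM2l ?ltr0n //.
    by rewrite ler_peMl ?(ltW s_gt0) // norm_intr_ge1 ?intr_int ?intr_eq0.
  have -> : 4 * (max1 x1 * max1 x2 * (max1 x3 * max1 x4)) =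
     2 * (max1 x1 * max1 x2) * (2 * (max1 x3 * max1 x4)) by ring.
  by rewrite normrM ler_pM ?normr_ge0 ?norm_sub_max1.
by rewrite ler_pM2l ?ltr0n.
Qed.

(* Witness: the unit [k - s + t - u], whose relative norm to [Q(s)] is [-1]. *)
Lemma small_generator : exists A B C E : int,
  ((C != 0) || (E != 0)) /\ mahler_int A B C E <= 54 * s.
Proof.
have [ss _ _ [tt tu uu]] := theta_rel.
have [A [B [DA DB]]] : exists A B : int, coord1 A B = K /\ coord2 B = -1.
  rewrite /coord1 /coord2; case: (odd k); first by exists k%:Z, (-1).
  (* For even [k], [- s = 1 - 2 w]. *)
  by exists (k%:Z + 1), (- 2); rewrite /K; split; field.
exists A, B, 1, (- 1); split=> //; rewrite mahler_intE DA DB.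
set x1 := elt _ _ _ _ s t u; set x2 := elt _ _ _ _ s (- t) (- u).
set x3 := elt _ _ _ _ (- s) u (- t); set x4 := elt _ _ _ _ (- s) (- u) t.
have Dx1 : x1 = (K - s) + (t - u) by rewrite /x1 /elt; ring.
have Dx2 : x2 = (K - s) - (t - u) by rewrite /x2 /elt; ring.
have Dx3 : x3 = K + s + t + u by rewrite /x3 /elt; ring.
have Dx4 : x4 = K + s - t - u by rewrite /x4 /elt; ring.
have K0 := ltW K_gt0; have s0 := ltW s_gt0; have t0 := t_ge0; have u0 := u_ge0.
have Ks := ltW K_lt_s.
have sK : s - K <= 1.
  rewrite lerBlDl -ler_sqr ?nnegrE ?addr_ge0 // expr2 ss.
  have -> : (K + 1) ^+ 2 = K ^+ 2 + 1 + 2 * K by ring.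
  by rewrite lerDl mulr_ge0.
(* [(t - u)^2 = 2 s (s - K)], and [s (s - K) <= (s + K) (s - K) = 1]. *)
have tu2 : `|t - u| <= 2.
  rewrite -ler_sqr ?nnegrE ?normr_ge0 ?ler0n // real_normK; last first.
    by rewrite rpredB ?ger0_real.
  have -> : (t - u) ^+ 2 = 2 * (s * (s - K)).
    transitivity (t * t + u * u - 2 * (t * u)); first by ring.
    by rewrite tt uu tu; ring.
  rewrite expr2 ler_pM2l ?ltr0n //; apply: le_trans (_ : 1 <= 2); last by rewrite ler1n.
  have <- : (s + K) * (s - K) = 1.
    by transitivity (s * s - K ^+ 2); [ring | rewrite ss; ring].
  by rewrite ler_wpM2r ?subr_ge0 // lerDl.
have Ks1 : `|K - s| <= 1 by rewrite distrC ger0_norm ?subr_ge0.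
have three : 3 = 1 + 2 :> algC by ring.
have m1 : max1 x1 <= 3.
  apply: max1_le; first by rewrite ler1n.
  by rewrite Dx1 three (le_trans (ler_normD _ _)) // lerD.
have m2 : max1 x2 <= 3.
  apply: max1_le; first by rewrite ler1n.
  by rewrite Dx2 three (le_trans (ler_normB _ _)) // lerD.
have x3_ge0 : 0 <= x3 by rewrite Dx3 !addr_ge0.
have x3_ge1 : 1 <= `|x3|.
  rewrite ger0_norm // Dx3 -!addrA; apply: le_trans s_ge1 _.
  by rewrite addrCA lerDl !addr_ge0.
have m3 : max1 x3 <= 6 * s.
  apply: max1_le; first by rewrite mulr_ege1 ?s_ge1 ?ler1n.
  rewrite ger0_norm // Dx3; have -> : 6 * s = s + s + 2 * s + 2 * s by ring.
  by rewrite !lerD ?t_le_2s ?u_le_2s.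
(* [x3 x4 = -1] and [x3 >= 1]. *)
have m4 : max1 x4 <= 1.
  apply: max1_le => //.
  have x34 : x3 * x4 = -1.
    transitivity ((K + s) ^+ 2 - (t * t + u * u + 2 * (t * u))); first by rewrite Dx3 Dx4; ring.
    transitivity (K ^+ 2 - s * s); first by rewrite tt uu tu; ring.
    by rewrite ss; ring.
  have : `|x3 * x4| <= 1 by rewrite x34 normrN normr1.
  by rewrite normrM; apply: le_trans; rewrite ler_peMl.
have -> : 54 * s = 3 * 3 * (6 * s * 1) by ring.
by rewrite !ler_pM ?mulr_ge0 ?max1_ge0.
Qed.

Lemma mahler_OK_exists : exists m : algC,
  [/\ is_mahler_OK t m, s <= m & m <= 54 * s].
Proof.
have [A0 [B0 [C0 [E0 [nz0 le0]]]]] := small_generator.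
pose P (A B C E : int) := (C != 0) || (E != 0).
(* Doubling the measure makes it dominate the coordinates, as [int4_argmin] demands. *)
pose F (A B C E : int) : algC := 2 * mahler_int A B C E.
have [|A [B [C [E [nz min]]]]] := @int4_argmin F P A0 B0 C0 E0 _ nz0.
  by move=> A B C E _; apply: int_coord_bound.
have {}min A' B' C' E' : (C' != 0) || (E' != 0) -> mahler_int A B C E <= mahler_int A' B' C' E'.
  by move=> /(min A' B'); rewrite /F ler_pM2l ?ltr0n.
exists (mahler_int A B C E); split.
- split=> [|x m' x_OK x_gen x_m'].
    exists (int_elt A B C E); have [? ?] := int_elt_generator A B nz.
    by do 2!split=> //; apply/mahler_int_elt.
  have [A' [B' [C' [E' [nz' Dx]]]]] := generator_int_elt x_OK x_gen.
  by move: x_m'; rewrite Dx => /(mahler_int_elt A' B' m' nz') ->; apply: min.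
- exact: mahler_int_ge.
- exact: le_trans (min _ _ _ _ nz0) le0.
Qed.

(** * The discriminant *)

Lemma int_elt_horner (A B C E : int) : exists q : {poly rat},
  forall s' t' u', quartic_rel K s' t' u' ->
    (ratp q).[t'] = elt (coord1 A B) (coord2 B) C%:~R E%:~R s' t' u'.
Proof.
have /CratP [a Da] := coord1_rat A B; have /CratP [b Db] := coord2_rat B.
have [q Dq] := elt_horner a b C%:~R E%:~R k_gt0.
by exists q => s' t' u' rel; rewrite (Dq _ _ _ rel) Da Db !ratr_int.
Qed.

(** The determinant on the integral basis is [- 16 q s^3] with [q = coord2 1] equal to 1 or 1/2, so
    [D] is [256 s^6] or [64 s^6]; the bounds cover both parities. *)
Lemma abs_disc_exists : exists D : algC,
  is_abs_disc t D /\ (s ^+ 6 <= D <= 256 * s ^+ 6).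
Proof.
have rel1 := theta_rel; have rel2 := quartic_rel_neg rel1.
have rel3 := quartic_rel_rot rel1; have rel4 := quartic_rel_rot3 rel1.
have [ss _ _ [tt tu uu]] := rel1.
have Dt : t = elt 0 0 1 0 s t u by rewrite /elt; ring.
have [p [Dp p_monic] p_min] := minCpolyP t.
have [q0 Dq0] := int_elt_horner 1 0 0 0; have [q1 Dq1] := int_elt_horner 0 1 0 0.
have [q2 Dq2] := int_elt_horner 0 0 1 0; have [q3 Dq3] := int_elt_horner 0 0 0 1.
(* The order follows the second entries of the triples in [rel1] to [rel4]. *)
pose c (i : 'I_4) := nth 0 [:: t; - t; u; - u] i.
pose w (j : 'I_4) := nth 0 [:: q0; q1; q2; q3] j.
have coord10 : coord1 0 0 = 0 by rewrite /coord1; case: (odd k); rewrite ?mul0r ?addr0.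
have coord11 : coord1 1 0 = 1 by rewrite /coord1; case: (odd k); rewrite ?mul0r ?addr0.
have coord20 : coord2 0 = 0 by rewrite /coord2; case: (odd k); rewrite ?mul0r.
have coordD (A B : int) : A%:~R + B%:~R * coord1 0 1 = coord1 A B.
  by rewrite /coord1; case: (odd k); rewrite ?mulr0 ?addr0 ?add0r ?mul1r.
have coordM (B : int) : B%:~R * coord2 1 = coord2 B.
  by rewrite /coord2; case: (odd k); rewrite ?mulr1 ?mul1r.
have sum_w (a : 'I_4 -> int) : \sum_(j < 4) (a j)%:~R * (ratp (w j)).[t] =
    int_elt (a ord0) (a (lift ord0 ord0)) (a (lift ord0 (lift ord0 ord0)))
      (a (lift ord0 (lift ord0 (lift ord0 ord0)))).
  rewrite !big_ord_recl big_ord0 /w /=.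
  rewrite (Dq0 _ _ _ rel1) (Dq1 _ _ _ rel1) (Dq2 _ _ _ rel1) (Dq3 _ _ _ rel1).
  rewrite coord10 coord11 coord20 /int_elt -[coord1 (a _) _]coordD -[coord2 (a _)]coordM /elt.
  by ring.
exists (`|\det (\matrix_(i < 4, j < 4) (ratp (w j)).[c i])| ^+ 2); split.
  exists p, 4%N, c, w; split.
    split=> //; split; first by rewrite /ratp -Dp root_minCpoly.
    by move=> q q_neq0 q_root; apply: dvdp_leq; rewrite // -p_min.
  split.
    rewrite /ratp -Dp {1}Dt minCpoly_elt ?rpred0 ?rpred1 ?oner_neq0 //.
    rewrite /conjs !big_cons big_nil !big_ord_recl big_ord0 /c /=.
    by rewrite /elt !mul0r !mul1r !add0r !addr0.
  split.
    move=> j; have wE : exists A B C E : int, (ratp (w j)).[t] = int_elt A B C E.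
      case: j => [[|[|[|[|//]]]] lt_j] /=; rewrite /w /=.
      - by exists 1, 0, 0, 0; apply: Dq0.
      - by exists 0, 1, 0, 0; apply: Dq1.
      - by exists 0, 0, 1, 0; apply: Dq2.
      - by exists 0, 0, 0, 1; apply: Dq3.
    case: wE => A [B [C [E ->]]]; split; last exact: int_elt_Aint.
    apply/inQgen_eltP; exists (coord1 A B), (coord2 B), C%:~R, E%:~R.
    by rewrite coord1_rat coord2_rat !rpred_int.
  split.
    move=> x [/inQgen_eltP [a [b [c' [e [[a_rat b_rat c_rat e_rat] ->]]]]] x_int].
    have [A [B [C [E [-> -> -> ->]]]]] := integral_elt a_rat b_rat c_rat e_rat x_int.
    by exists (fun j => nth 0 [:: A; B; C; E] j); rewrite sum_w.
  split=> // a; rewrite sum_w => /elt_indep [] //; rewrite ?coord1_rat ?coord2_rat ?rpred_int //.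
  move=> a0 b0 /eqP c0 /eqP e0.
  have {}b0 : a (lift ord0 ord0) = 0.
    apply/eqP; rewrite -(intr_eq0 algC); move/eqP: b0; rewrite /coord2.
    by case: (odd k) => //; rewrite mulf_eq0 invr_eq0 pnatr_eq0 orbF.
  have {}a0 : a ord0 = 0.
    by apply/eqP; rewrite -(intr_eq0 algC) -a0 b0 /coord1; case: (odd k); rewrite ?mul0r ?addr0.
  move: c0 e0; rewrite !intr_eq0 => /eqP c0 /eqP e0.
  case=> [[|[|[|[|//]]]] lt_j].
  - by rewrite -a0; congr a; apply: val_inj.
  - by rewrite -b0; congr a; apply: val_inj.
  - by rewrite -c0; congr a; apply: val_inj.
  - by rewrite -e0; congr a; apply: val_inj.
pose f (i j : nat) := (ratp (nth 0 [:: q0; q1; q2; q3] j)).[nth 0 [:: t; - t; u; - u] i].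
have -> : \matrix_(i < 4, j < 4) (ratp (w j)).[c i] = \matrix_(i < 4, j < 4) f i j by [].
have -> : \det (\matrix_(i < 4, j < 4) f i j) = - (16 * coord2 1 * s ^+ 3).
  rewrite det4 !big_ord_recl big_ord0 /f /= /bump /=.
  rewrite !(Dq0 _ _ _ rel1, Dq1 _ _ _ rel1, Dq2 _ _ _ rel1, Dq3 _ _ _ rel1).
  rewrite !(Dq0 _ _ _ rel2, Dq1 _ _ _ rel2, Dq2 _ _ _ rel2, Dq3 _ _ _ rel2).
  rewrite !(Dq0 _ _ _ rel3, Dq1 _ _ _ rel3, Dq2 _ _ _ rel3, Dq3 _ _ _ rel3).
  rewrite !(Dq0 _ _ _ rel4, Dq1 _ _ _ rel4, Dq2 _ _ _ rel4, Dq3 _ _ _ rel4).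
  rewrite coord10 coord11 coord20 /elt.
  transitivity (- (8 * coord2 1 * s * (t * t + u * u))); first by ring.
  by rewrite tt uu; ring.
have s0 := ltW s_gt0.
have s6 : 0 <= s ^+ 6 by rewrite exprn_ge0.
have [q_ge0 q_ge q_le] : [/\ 0 <= coord2 1, 2^-1 <= coord2 1 & coord2 1 <= 1].
  rewrite /coord2; case: (odd k); rewrite ?mul1r; split=> //.
  - by rewrite invf_le1 ?ltr0n // ler1n.
  - by rewrite invr_ge0 ler0n.
  - by rewrite invf_le1 ?ltr0n // ler1n.
rewrite normrN ger0_norm; last by rewrite !mulr_ge0 ?exprn_ge0.
have -> : (16 * coord2 1 * s ^+ 3) ^+ 2 = 256 * coord2 1 ^+ 2 * s ^+ 6 by ring.
apply/andP; split.
  rewrite ler_peMl //; apply: le_trans (_ : 256 * (2^-1) ^+ 2 <= _).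
    have -> : 256 * 2^-1 ^+ 2 = 64 :> algC by field.
    by rewrite ler1n.
  by rewrite ler_pM2l ?ltr0n // ler_sqr ?nnegrE ?invr_ge0 ?ler0n.
rewrite ler_wpM2r // -[X in _ <= X]mulr1 ler_pM2l ?ltr0n //.
by rewrite expr_le1.
Qed.

(** * Comparison of the discriminant with the minimal measure *)

(** Sixth roots of the bounds on [D] are compared with [s]: the sixth power of [3.-root 16] is 256,
    matching [D <= 256 s^6] with [s <= m], while [s^6 <= D] turns [54 s] into the upper bound. *)
Lemma disc_mahler_bounds : exists D m : algC,
  [/\ is_abs_disc t D, is_mahler_OK t m,
      (3.-root 16)^-1 * 6.-root D <= m & m <= 60 * 6.-root D].
Proof.
have [D [disc_D /andP [D_ge D_le]]] := abs_disc_exists.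
have [m [mahler_m m_ge m_le]] := mahler_OK_exists.
have s0 := ltW s_gt0.
have D_ge0 : 0 <= D by apply: le_trans D_ge; rewrite exprn_ge0.
have r_ge0 : 0 <= 6.-root D by rewrite rootC_ge0.
have r16_gt0 : 0 < 3.-root 16 :> algC by rewrite rootC_gt0 // ltr0n.
exists D, m; split=> //.
  apply: le_trans m_ge; rewrite mulrC ler_pdivrMr //.
  rewrite -(@ler_pXn2r _ 6) ?nnegrE ?mulr_ge0 ?(ltW r16_gt0) // rootCK // exprMn mulrC.
  rewrite (_ : (3.-root 16) ^+ 6 = 256) //.
  by rewrite (exprM _ 3 2) rootCK //; ring.
apply: le_trans m_le _; apply: ler_pM; rewrite ?ler0n ?ler_nat //.
by rewrite -(@ler_pXn2r _ 6) ?nnegrE // rootCK.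
Qed.

End Field.

Theorem theorem5p2 :
  (forall N : nat, exists k : nat, (N < k)%N /\ squarefree (k ^ 2 + 1)) /\
  exists k0 : nat, forall k : nat, (k0 <= k)%N -> (0 < k)%N -> squarefree (k ^ 2 + 1) ->
    exists D m : algC,
      [/\ is_abs_disc (theta_k k) D, is_mahler_OK (theta_k k) m,
          (3.-root 16)^-1 * 6.-root D <= m & m <= 60 * 6.-root D].
Proof.
split; first exact: infinite_squarefree_sqrS.
by exists 0%N => k _ k_gt0 sqf_k; apply: disc_mahler_bounds.
Qed.
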